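(* Let $A\in\operatorname{EigSpSm}(2n)$, and let $2k,2\ell,2m$ be the dimensions of $\mathscr{E}_-,\mathscr{E}_0,\mathscr{E}_+$, respectively (so $k+\ell+m=n$). Then there exist a real orthogonal $2n\times 2n$ matrix $U$, real numbers $\beta_1,\dots,\beta_{k+m},\delta_1,\dots,\delta_{k+m}$, and indices $i_1<\cdots<i_k$ and $j_1<\cdots<j_m$ with $\{i_1,\dots,i_k\}\sqcup\{j_1,\dots,j_m\}=\{1,\dots,k+m\}$, such that $\beta_i>0,\ \delta_i=0$ for $i\in\{i_1,\dots,i_k\}$, $\beta_j=0,\ \delta_j>0$ for $j\in\{j_1,\dots,j_m\}$, and $$U^{\top}A_-^{1/2}JA_-^{1/2}U=0_{2\ell,2\ell}\oplus\begin{pmatrix}0&\beta_1\\-\beta_1&0\end{pmatrix}\oplus\cdots\oplus\begin{pmatrix}0&\beta_{k+m}\\-\beta_{k+m}&0\end{pmatrix},$$ $$U^{\top}A_+^{1/2}JA_+^{1/2}U=0_{2\ell,2\ell}\oplus\begin{pmatrix}0&\delta_1\\-\delta_1&0\end{pmatrix}\oplus\cdots\oplus\begin{pmatrix}0&\delta_{k+m}\\-\delta_{k+m}&0\end{pmatrix},$$ and such that the following holds. Let $e_1,\dots,e_{2n}$ be the standard unit vectors of $\mathbb{R}^{2n}$ and put $$P=[e_1,e_3,\dots,e_{2n-1},e_2,e_4,\dots,e_{2n}],$$ $$\Pi_-=[e_{\ell+i_1},\dots,e_{\ell+i_k},e_{n+\ell+i_1},\dots,e_{n+\ell+i_k}],\qquad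 \Pi_+=[e_{\ell+j_1},\dots,e_{\ell+j_m},e_{n+\ell+j_1},\dots,e_{n+\ell+j_m}],$$ $$\widetilde{D}_-=\operatorname{diag}(\beta_{i_1},\dots,\beta_{i_k}),\qquad \widetilde{D}_+=\operatorname{diag}(\delta_{j_1},\dots,\delta_{j_m}),$$ $$\widetilde{M}_-=J_{2n}A_-^{1/2}UP\,\Pi_-\left(\widetilde{D}_-^{-1/2}\oplus\widetilde{D}_-^{-1/2}\right)J_{2k}^{\top},\qquad \widetilde{M}_+=J_{2n}A_+^{1/2}UP\,\Pi_+\left(\widetilde{D}_+^{-1/2}\oplus\widetilde{D}_+^{-1/2}\right)J_{2m}^{\top}.$$ Let $\widetilde{M}_0$ be any $2n\times 2\ell$ real matrix whose columns form a symplectic basis of $\mathscr{E}_0$. Then $\widetilde{M}=\widetilde{M}_0\diamond\widetilde{M}_-\diamond\widetilde{M}_+$ is a symplectic matrix, and, up to the ordering of the diagonal entries of $D$, $$\widetilde{M}^{\top}A\widetilde{M}=D\oplus D,\qquad D=(-\widetilde{D}_-)\oplus 0_{\ell,\ell}\oplus\widetilde{D}_+.$$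
   Context: $J=J_{2n}=\begin{pmatrix}0&I_n\\-I_n&0\end{pmatrix}$ and $\langle x,y\rangle=x^{\top}y$. A $2n\times 2n$ real matrix $M$ is symplectic if $M^{\top}J_{2n}M=J_{2n}$. For a subset $\mathscr{X}\subseteq\mathbb{R}^{2n}$, $\mathscr{X}^{\perp_{\operatorname{s}}}=\{u\in\mathbb{R}^{2n}:\langle u,Jv\rangle=0\ \forall v\in\mathscr{X}\}$. A linear subspace $\mathscr{W}$ is a symplectic subspace if $\mathscr{W}\cap\mathscr{W}^{\perp_{\operatorname{s}}}=\{0\}$ (the zero subspace is allowed); such a subspace has even dimension. Symplectic subspaces $\mathscr{W},\mathscr{Z}$ are symplectically orthogonal to each other if $\mathscr{Z}\subseteq\mathscr{W}^{\perp_{\operatorname{s}}}$. A symplectic basis of a $2\ell$-dimensional symplectic subspace is a basis $u_1,\dots,u_\ell,v_1,\dots,v_\ell$ (in this order) with $\langle u_i,Jv_j\rangle=\delta_{ij}$ (Kronecker delta) and $\langle u_i,Ju_j\rangle=\langle v_i,Jv_j\rangle=0$. For a real symmetric $A$, $|A|=(A^2)^{1/2}$, $A_-=\frac12(|A|-A)$ and $A_+=\frac12(|A|+A)$, both positive semidefinite; $B^{1/2}$ is the positive semidefinite square root of a positive semidefinite $B$. For a $2n\times 2n$ real symmetric $A$, $\mathscr{E}_-,\mathscr{E}_0,\mathscr{E}_+$ are the subspaces spanned by the eigenvectors of $A$ corresponding to its negative, zero, and positive eigenvalues, respectively. $\operatorname{EigSpSm}(2n)$ is the set of $2n\times 2n$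 real symmetric $A$ for which $\mathscr{E}_-,\mathscr{E}_0,\mathscr{E}_+$ are pairwise symplectically orthogonal symplectic subspaces, each invariant under $JA$. Symplectic concatenation: if $M$ is a $2n\times 2k$ matrix with columns $u_1,\dots,u_k,v_1,\dots,v_k$ and $N$ is a $2n\times 2\ell$ matrix with columns $x_1,\dots,x_\ell,y_1,\dots,y_\ell$, then $M\diamond N=[u_1,\dots,u_k,x_1,\dots,x_\ell,v_1,\dots,v_k,y_1,\dots,y_\ell]$. $0_{p,q}$ is the $p\times q$ zero matrix and $\oplus$ is the usual block-diagonal direct sum. If $k$, $\ell$ or $m$ is $0$, the corresponding blocks are absent. *)

(* Defs.v *)
From mathcomp Require Import all_boot all_order all_algebra.
From mathcomp Require Import classical_sets reals.

Set Implicit Arguments.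
Unset Strict Implicit.
Unset Printing Implicit Defensive.

Import Order.TTheory GRing.Theory Num.Theory.

Local Open Scope ring_scope.
Local Open Scope classical_set_scope.

(* R^(2n) is 'cV[R]_(n + n), so that the n x n blocks of J are visible in the
   type; indices start at 0, and n may be 0. *)

Section Matrices.
Variable R : realType.

Definition Jmx (n : nat) : 'M[R]_(n + n) := block_mx 0 1%:M (- 1%:M) 0.

Definition dotv (N : nat) (x y : 'cV[R]_N) : R := (x^T *m y) 0 0.

Definition symplectic_mx (n : nat) (M : 'M[R]_(n + n)) : Prop :=
  M^T *m Jmx n *m M = Jmx n.

Definition orthogonal_mx (N : nat) (U : 'M[R]_N) : Prop := U^T *m U = 1%:M.

Definition psd_mx (N : nat) (B : 'M[R]_N) : Prop :=
  B^T = B /\ forall x : 'cV[R]_N, 0 <= dotv x (B *m x).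

(* For positive semidefinite B the set below is a singleton; the default value
   0 is only reached when B has no positive semidefinite square root. *)
Definition sqrtmx (N : nat) (B : 'M[R]_N) : 'M[R]_N :=
  xget 0 [set C | psd_mx C /\ C *m C = B].

Definition absmx (N : nat) (A : 'M[R]_N) : 'M[R]_N := sqrtmx (A *m A).

Definition negmx (N : nat) (A : 'M[R]_N) : 'M[R]_N := 2^-1 *: (absmx A - A).

Definition posmx (N : nat) (A : 'M[R]_N) : 'M[R]_N := 2^-1 *: (absmx A + A).

Definition dsum (m1 n1 m2 n2 : nat) (X : 'M[R]_(m1, n1)) (Y : 'M[R]_(m2, n2)) :
    'M[R]_(m1 + m2, n1 + n2) :=
  block_mx X 0 0 Y.

(* The linear span of a possibly infinite set of vectors: the least subspace
   containing it. Such a subspace always exists, so 0 is never a default. *)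
Definition set_span (vT : vectType R) (X : set vT) : {vspace vT} :=
  xget 0%VS [set W : {vspace vT} |
    (forall v, X v -> v \in W) /\
    (forall W' : {vspace vT}, (forall v, X v -> v \in W') -> (W <= W')%VS)].

Definition eig_span (N : nat) (A : 'M[R]_N) (S : set R) : {vspace 'cV[R]_N} :=
  set_span [set v | v != 0 /\ exists2 a, S a & A *m v = a *: v].

Definition eig_neg (N : nat) (A : 'M[R]_N) := eig_span A [set a | a < 0].
Definition eig_zero (N : nat) (A : 'M[R]_N) := eig_span A [set 0].
Definition eig_pos (N : nat) (A : 'M[R]_N) := eig_span A [set a | 0 < a].

Definition sperp (n : nat) (X : set 'cV[R]_(n + n)) : set 'cV[R]_(n + n) :=
  [set u | forall v, X v -> dotv u (Jmx n *m v) = 0].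

Definition symplectic_subspace (n : nat) (W : {vspace 'cV[R]_(n + n)}) : Prop :=
  [set` W] `&` sperp [set` W] = [set 0].

Definition symplectically_orthogonal (n : nat)
    (W Z : {vspace 'cV[R]_(n + n)}) : Prop :=
  [set` Z] `<=` sperp [set` W].

Definition invariant_subspace (N : nat) (B : 'M[R]_N)
    (W : {vspace 'cV[R]_N}) : Prop :=
  forall v, v \in W -> B *m v \in W.

Definition EigSpSm (n : nat) (A : 'M[R]_(n + n)) : Prop :=
  [/\ A^T = A,
      [/\ symplectic_subspace (eig_neg A),
          symplectic_subspace (eig_zero A) &
          symplectic_subspace (eig_pos A)],
      [/\ symplectically_orthogonal (eig_neg A) (eig_zero A),
          symplectically_orthogonal (eig_neg A) (eig_pos A) &
          symplectically_orthogonal (eig_zero A) (eig_pos A)] &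
      [/\ invariant_subspace (Jmx n *m A) (eig_neg A),
          invariant_subspace (Jmx n *m A) (eig_zero A) &
          invariant_subspace (Jmx n *m A) (eig_pos A)]].

(* The columns of M, in order u_1, .., u_l, v_1, .., v_l. *)
Definition symplectic_basis (n l : nat) (W : {vspace 'cV[R]_(n + n)})
    (M : 'M[R]_(n + n, l + l)) : Prop :=
  let u (i : 'I_l) : 'cV[R]_(n + n) := col (lshift l i) M in
  let v (i : 'I_l) : 'cV[R]_(n + n) := col (rshift l i) M in
  basis_of W [seq col j M | j : 'I_(l + l)] /\
  forall i j : 'I_l,
    [/\ dotv (u i) (Jmx n *m v j) = (i == j)%:R,
        dotv (u i) (Jmx n *m u j) = 0 &
        dotv (v i) (Jmx n *m v j) = 0].

Definition sconcat (N k l : nat) (M : 'M[R]_(N, k + k)) (M' : 'M[R]_(N, l + l)) :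
    'M[R]_(N, (k + l) + (k + l)) :=
  row_mx (row_mx (lsubmx M) (lsubmx M')) (row_mx (rsubmx M) (rsubmx M')).

(* The matrix whose c-th column is the standard unit vector of index f c. *)
Definition unit_cols (N p : nat) (f : 'I_p -> nat) : 'M[R]_(N, p) :=
  \matrix_(r < N, c < p) ((r : nat) == f c)%:R.

Definition Pmx (n : nat) : 'M[R]_(n + n) :=
  row_mx (unit_cols (n + n) (fun c : 'I_n => c.*2))
         (unit_cols (n + n) (fun c : 'I_n => c.*2.+1)).

Definition Pimx (n l p q : nat) (idx : 'I_q -> 'I_p) : 'M[R]_(n + n, q + q) :=
  row_mx (unit_cols (n + n) (fun a : 'I_q => l + idx a)%N)
         (unit_cols (n + n) (fun a : 'I_q => n + l + idx a)%N).

Definition skew2 (b : R) : 'M[R]_2 :=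
  block_mx 0 b%:M (- b%:M) 0 : 'M[R]_(1 + 1).

Lemma skew_blocks_size (n k l m : nat) : (k + l + m)%N = n ->
  ((l + l) + \sum_(i < k + m) 2)%N = (n + n)%N.
Proof.
by move=> <-; rewrite sum_nat_const card_ord muln2 !addnn -doubleD addnCA addnA.
Qed.

(* 0_{2l,2l} followed by the 2 x 2 blocks of b_1, .., b_{k+m}. *)
Definition skew_blocks (n k l m : nat) (e : (k + l + m)%N = n)
    (b : 'I_(k + m) -> R) : 'M[R]_(n + n) :=
  castmx (skew_blocks_size e, skew_blocks_size e)
    (dsum (0 : 'M[R]_(l + l)) (\mxdiag_(i < k + m) skew2 (b i))).

Lemma sconcat_size (n k l m : nat) : (k + l + m)%N = n ->
  ((l + k + m) + (l + k + m))%N = (n + n)%N.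
Proof. by move=> <-; rewrite (addnC l k). Qed.

End Matrices.

Arguments Jmx {R} n.
Arguments Pmx {R} n.
Arguments Pimx {R} n l {p q} idx.

(* Main.v *)
Require Import Defs.
From mathcomp Require Import all_boot all_order all_fingroup all_algebra.
From mathcomp Require Import classical_sets reals.
From mathcomp Require Import sesquilinear spectral complex.

Set Implicit Arguments.
Unset Strict Implicit.
Unset Printing Implicit Defensive.

Import Order.TTheory GRing.Theory Num.Theory.

Local Open Scope ring_scope.

(** The three spans of eigenvectors are the ranges of orthogonal projections Pn,
    P0, Pp with sum 1, and their pairwise symplectic orthogonality says exactly
    that Pa J Pb = 0 for distinct a and b. So J commutes with each of the
    projections ([splitting_J]) and maps each eigenspace onto itself; everything
    can then be done inside one eigenspace at a time.

    Take the negative one, of dimension 2k, and let S be the square root of the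
    negative part of A. The matrix S J S is skew-symmetric and is invertible
    on the range of Pn, because S and J are. By the normal form of
    skew-symmetric matrices ([skew_normal_form]) there is an orthonormal basis W
    of the range of Pn for which S J S = W K W^T, where K has rows
    (0, D) and (-D, 0) with D positive diagonal ([skew_range_form]). The same
    works for the positive eigenspace. Orthonormal bases of the three eigenspaces
    together form an orthogonal matrix ([frame_gram]), in which both skew-symmetric
    matrices have their normal form ([frame_neg], [frame_pos]); alternating the two
    halves of its columns with the permutation matrix [Pmx] gives U. Putting the
    negative planes first means that the two index families are the two canonical
    injections into a sum.

    With U so chosen, multiplication by [Pmx] and [Pimx] selects the basis W again,
    so the columns to be concatenated form X = J S W (D^(-1/2) + D^(-1/2)) J^T,
    where + is the direct sum. Substituting S J S = W K W^T gives X^T J X = J and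
    X^T S^2 X = D + D ([williamson_cols_J], [williamson_cols_sq]), and A is - S^2 on the negative
    eigenspace and S^2 on the positive one. Columns belonging to different
    eigenspaces are orthogonal for J and for A, so the symplectic concatenation is
    symplectic and diagonalizes A ([williamson_basis]).

    The real spectral theorem ([symmetric_diagonalization]), which underlies both
    the square roots and the normal form, is deduced from the complex one by
    descending a single nonzero eigenvalue. *)

(** * The real spectral theorem *)

Section SpectralTheorem.
Variable R : rcfType.

Lemma gram_eq0 (m n : nat) (X : 'M[R]_(m, n)) : X^T *m X = 0 -> X = 0.
Proof.
move=> X0; apply/matrixP=> i j; have /matrixP/(_ j j) := X0.
rewrite !mxE => /eqP; under eq_bigr do rewrite mxE -expr2.
rewrite psumr_eq0 => [/allP/(_ i)|? _]; last exact: sqr_ge0.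
by rewrite mem_index_enum sqrf_eq0 => /(_ isT) /eqP.
Qed.

(** Over the complex numbers X is unitarily diagonalizable with real spectrum,
    and the spectrum is not identically zero since X is not; a real number that is
    an eigenvalue over the complex numbers is one over the reals. *)
Lemma symmetric_eigenvalue_neq0 (n : nat) (X : 'M[R]_n) : X^T = X -> X != 0 ->
  exists2 a, a != 0 & eigenvalue X a.
Proof.
move=> symX X0; pose XC := map_mx (real_complex R) X.
have hermX : XC \is hermsymmx.
  apply: realsym_hermsym; last first.
    by apply/mxOverP=> i j; rewrite mxE; apply/complex_realP; exists (X i j).
  by apply/is_hermitianmxP; rewrite expr0 scale1r map_mx_id // map_trmx symX.
have /orthomx_spectralP XCE := hermitian_normalmx hermX.
have realD := hermitian_spectral_diag_real hermX.
have [j Dj] : exists j, spectral_diag XC 0 j != 0.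
  apply/existsP/existsPn => D0; case/eqP: X0.
  apply: (@map_mx_inj _ _ (real_complex R)); rewrite map_mx0 -/XC XCE.
  suff -> : spectral_diag XC = 0 by rewrite linear0 mulmx0 mul0mx.
  by apply/rowP=> j; have := D0 j; rewrite negbK mxE => /eqP.
have /mxOverP/(_ 0 j)/complex_realP[a aE] := realD.
exists a; first by apply: contraNneq Dj => a0; rewrite aE a0.
rewrite -(eigenvalue_map (real_complex R)) /= -aE.
have unitP := spectral_unit XC.
apply/eigenvalueP; exists (row j (spectralmx XC)).
  rewrite -/XC [X in _ *m X]XCE mulmxA mulmxA -row_mul mulmxV // row1.
  by rewrite -rowE row_diag_mx -scalemxAl -rowE.
apply: contraL unitP => /eqP r0; rewrite unitmxE (expand_det_row _ j).
rewrite big1 ?unitr0 // => i _.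
by have /rowP/(_ i) := r0; rewrite !mxE => ->; rewrite mul0r.
Qed.

Lemma symmetric_eigenvector (n : nat) (X : 'M[R]_n) : X^T = X -> X != 0 ->
  exists (v : 'cV[R]_n) (a : R), [/\ v^T *m v = 1, a != 0 & X *m v = a *: v].
Proof.
move=> symX X0; have [a a0 /eigenvalueP[u ua u0]] := symmetric_eigenvalue_neq0 symX X0.
pose t := (u *m u^T) 0 0.
have uuE : u *m u^T = t%:M by rewrite [LHS]mx11_scalar.
have t0 : 0 < t.
  rewrite lt_def; apply/andP; split; last first.
    rewrite /t mxE; apply: sumr_ge0 => i _; rewrite mxE -expr2; exact: sqr_ge0.
  apply: contraNneq u0 => t0; rewrite -(trmx_eq0 u); apply/eqP/gram_eq0.
  by rewrite trmxK uuE t0 raddf0.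
exists ((Num.sqrt t)^-1 *: u^T), a; split=> //.
  rewrite [(_ *: u^T)^T]linearZ /= trmxK -scalemxAl -scalemxAr scalerA uuE -invfM -expr2.
  by rewrite sqr_sqrtr ?ltW // scale_scalar_mx mulVf ?gt_eqF.
rewrite -scalemxAr scalerA mulrC -scalerA; congr (_ *: _).
by apply: trmx_inj; rewrite trmx_mul trmxK symX [(_ *: u^T)^T]linearZ /= trmxK ua.
Qed.

(** An orthonormal family of eigenvectors that is not yet a basis can be extended:
    the projection Q onto its orthogonal complement commutes with X, so an
    eigenvector is found in the range of Q. *)
Lemma partial_diagonalization (n r : nat) (X : 'M[R]_n) : X^T = X -> (r <= n)%N ->
  exists (V : 'M[R]_(n, r)) (d : 'rV[R]_r),
    V^T *m V = 1%:M /\ X *m V = V *m diag_mx d.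
Proof.
move=> symX; elim: r => [_|r IHr ltrn].
  by exists 0, 0; split; [apply/matrixP=> -[] | rewrite mulmx0 mul0mx].
have [V [d [VV XV]]] := IHr (ltnW ltrn).
pose Q := 1%:M - V *m V^T.
have VtQ : V^T *m Q = 0 by rewrite mulmxBr mulmx1 mulmxA VV mul1mx subrr.
have QQ : Q *m Q = Q by rewrite {1}/Q mulmxBl mul1mx -mulmxA VtQ mulmx0 subr0.
have symQ : Q^T = Q by rewrite /Q raddfB /= trmx_mul trmxK trmx1.
have Q0 : Q != 0.
  apply: contraTneq ltrn => /subr0_eq /(congr1 mxtrace).
  by rewrite mxtrace_mulC VV !mxtrace1 => /eqP; rewrite eqr_nat => /eqP ->; rewrite ltnn.
have VtX : V^T *m X = diag_mx d *m V^T.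
  by apply: trmx_inj; rewrite !trmx_mul trmxK symX XV tr_diag_mx.
have XQ : X *m Q = Q *m X.
  rewrite /Q mulmxBr mulmxBl mulmx1 mul1mx; congr (_ - _).
  by rewrite mulmxA XV -!mulmxA VtX.
(* A shift of X keeps X *m Q from vanishing, so that it has an eigenvector for
   a nonzero eigenvalue, which must lie in the range of Q. *)
have [c Y0] : exists c, (X + c%:M) *m Q != 0.
  have [XQ0|] := eqVneq (X *m Q) 0; last by exists 0; rewrite raddf0 addr0.
  by exists 1; rewrite mulmxDl XQ0 add0r mul1mx.
set Y := _ *m Q in Y0.
have symY : Y^T = Y.
  by rewrite trmx_mul [(X + _)^T]raddfD /= symX symQ tr_scalar_mx mulmxDr -XQ scalar_mxC -mulmxDl.
have [v [a [vv a0 Yv]]] := symmetric_eigenvector symY Y0.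
have Qv : Q *m v = v.
  apply: (scalerI a0); rewrite scalemxAr -Yv.
  by rewrite mulmxA -symY trmx_mul mulmxA symQ QQ -symQ -trmx_mul symY.
have Vv : V^T *m v = 0 by rewrite -Qv mulmxA VtQ mul0mx.
have vV : v^T *m V = 0 by apply: trmx_inj; rewrite trmx_mul trmxK Vv trmx0.
suff: exists (W : 'M[R]_(n, 1 + r)) (x : 'rV[R]_(1 + r)),
    W^T *m W = 1%:M /\ X *m W = W *m diag_mx x by [].
exists (row_mx v V), (row_mx (a - c)%:M d); split.
  by rewrite tr_row_mx mul_col_row vv VV Vv vV -scalar_mx_block.
rewrite mul_mx_row diag_mx_row mul_row_block !mulmx0 addr0 add0r XV; congr row_mx.
rewrite [X in v *m X]mx11_scalar !mxE eqxx mulr1n mul_mx_scalar.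
move: Yv; rewrite -mulmxA Qv mulmxDl mul_scalar_mx scalerBl => <-.
by rewrite addrK.
Qed.

Lemma symmetric_diagonalization (n : nat) (X : 'M[R]_n) : X^T = X ->
  exists (V : 'M[R]_n) (d : 'rV[R]_n), V^T *m V = 1%:M /\ X = V *m diag_mx d *m V^T.
Proof.
move=> symX; have [V [d [VV XV]]] := partial_diagonalization symX (leqnn n).
by exists V, d; split=> //; rewrite -XV -mulmxA (mulmx1C VV) mulmx1.
Qed.
End SpectralTheorem.

(** * Symplectic concatenation and congruence *)

Section SympConcat.
Variable R : realType.

(** [skewdiag_mx d] is the block matrix with rows (0, D) and (-D, 0), where D is the
    diagonal matrix of d: the normal form of a skew-symmetric matrix in the
    ordering of a symplectic basis. *)
Definition skewdiag_mx (p : nat) (d : 'rV[R]_p) : 'M[R]_(p + p) :=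
  block_mx 0 (diag_mx d) (- diag_mx d) 0.

(** The Gram matrix of a symplectic concatenation whose two parts are orthogonal:
    the direct sum of the two Gram matrices, taken quadrant by quadrant. *)
Definition sdsum (p q : nat) (X : 'M[R]_(p + p)) (Y : 'M[R]_(q + q)) :
    'M[R]_((p + q) + (p + q)) :=
  block_mx (dsum (ulsubmx X) (ulsubmx Y)) (dsum (ursubmx X) (ursubmx Y))
           (dsum (dlsubmx X) (dlsubmx Y)) (dsum (drsubmx X) (drsubmx Y)).

Lemma Jmx_skewdiag (n : nat) : Jmx n = skewdiag_mx (const_mx 1) :> 'M[R]_(n + n).
Proof. by rewrite /skewdiag_mx diag_const_mx. Qed.

Lemma skewdiag_mx0 (n : nat) : skewdiag_mx (0 : 'rV_n) = 0.
Proof. by rewrite /skewdiag_mx linear0 oppr0 block_mx0. Qed.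

Lemma sdsum_skewdiag (p q : nat) (x : 'rV[R]_p) (y : 'rV[R]_q) :
  sdsum (skewdiag_mx x) (skewdiag_mx y) = skewdiag_mx (row_mx x y).
Proof.
rewrite /sdsum /skewdiag_mx !(block_mxKul, block_mxKur, block_mxKdl, block_mxKdr).
by rewrite diag_mx_row /dsum opp_block_mx !oppr0 !block_mx0.
Qed.

Lemma sdsum_dsum (p q : nat) (x x' : 'M[R]_p) (y y' : 'M[R]_q) :
  sdsum (dsum x x') (dsum y y') = dsum (dsum x y) (dsum x' y').
Proof.
by rewrite /sdsum /dsum !(block_mxKul, block_mxKur, block_mxKdl, block_mxKdr) !block_mx0.
Qed.

Lemma sdsum1 (p q : nat) : sdsum (1%:M : 'M_(p + p)) (1%:M : 'M_(q + q)) = 1%:M.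
Proof.
have E r : 1%:M = dsum 1%:M 1%:M :> 'M[R]_(r + r) by rewrite scalar_mx_block.
by rewrite !E sdsum_dsum; congr dsum; rewrite /dsum -scalar_mx_block.
Qed.

Lemma sconcat_congr (N p q : nat) (M : 'M[R]_(N, p + p)) (M' : 'M[R]_(N, q + q))
    (Z : 'M[R]_N) :
  M^T *m Z *m M' = 0 -> M'^T *m Z *m M = 0 ->
  (sconcat M M')^T *m Z *m sconcat M M' = sdsum (M^T *m Z *m M) (M'^T *m Z *m M').
Proof.
rewrite -[M]hsubmxK -[M']hsubmxK /sconcat !(row_mxKl, row_mxKr).
move: (lsubmx M) (rsubmx M) (lsubmx M') (rsubmx M') => a b a' b'.
rewrite !tr_row_mx -!mulmxA !(mul_mx_row Z) !mul_col_row.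
move=> /eqP; rewrite block_mx_eq0 => /and4P[/eqP-> /eqP-> /eqP-> /eqP->].
move=> /eqP; rewrite block_mx_eq0 => /and4P[/eqP-> /eqP-> /eqP-> /eqP->].
by rewrite /sdsum !(block_mxKul, block_mxKur, block_mxKdl, block_mxKdr).
Qed.

Lemma sconcat_outer (N p q : nat) (M : 'M[R]_(N, p + p)) (M' : 'M[R]_(N, q + q))
    (X : 'M[R]_(p + p)) (Y : 'M[R]_(q + q)) :
  sconcat M M' *m sdsum X Y *m (sconcat M M')^T = M *m X *m M^T + M' *m Y *m M'^T.
Proof.
rewrite -[M]hsubmxK -[M']hsubmxK -[X]submxK -[Y]submxK /sconcat !(row_mxKl, row_mxKr).
move: (lsubmx M) (rsubmx M) (lsubmx M') (rsubmx M') => a b a' b'.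
rewrite /sdsum /dsum !(block_mxKul, block_mxKur, block_mxKdl, block_mxKdr).
rewrite !tr_row_mx !mul_row_block !mulmx0 !addr0 !add0r.
rewrite !add_row_mx !mul_row_col !mulmxDl.
by rewrite [RHS]addrACA.
Qed.

End SympConcat.

(** * Normal form of skew-symmetric matrices *)

Section SkewNormalForm.
Variable R : realType.

Lemma skewdiag_mx_inj (p q : nat) (d : 'rV[R]_p) (X : 'M[R]_(p + p, q)) :
  (forall i, d 0 i != 0) -> skewdiag_mx d *m X = 0 -> X = 0.
Proof.
move=> d0 /(congr1 (mulmx (skewdiag_mx (\row_i - (d 0 i)^-1)))).
rewrite mulmxA mulmx0 mulmx_block !(mulmx0, mul0mx, addr0, add0r) mulmxN mulNmx mulmx_diag.
suff -> : - diag_mx (\row_j ((\row_i - (d 0 i)^-1) 0 j * d 0 j)) = 1%:M.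
  by rewrite -scalar_mx_block mul1mx.
rewrite -diag_const_mx -linearN /=; congr diag_mx; apply/rowP => i.
by rewrite !mxE mulNr opprK mulVf.
Qed.

(** A unit eigenvector v of Z^T Z for a nonzero, hence positive, eigenvalue b^2
    spans together with w = - Z v / b a plane on which Z is b times a quarter
    turn; v and w are orthogonal because v^T Z v = 0. *)
Lemma skew_plane (n : nat) (Z : 'M[R]_n) : Z^T = - Z -> Z != 0 ->
  exists (v w : 'cV[R]_n) (b : R),
    [/\ 0 < b, [/\ v^T *m v = 1%:M, w^T *m w = 1%:M & v^T *m w = 0],
        Z *m v = - b *: w & Z *m w = b *: v].
Proof.
move=> skewZ Z0.
have symZZ : (Z^T *m Z)^T = Z^T *m Z by rewrite trmx_mul trmxK.
have ZZ0 : Z^T *m Z != 0 by apply: contra_neq Z0; apply: gram_eq0.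
have [v [a [vv a0 ZZv]]] := symmetric_eigenvector symZZ ZZ0.
have vZZv : (Z *m v)^T *m (Z *m v) = a%:M.
  by rewrite trmx_mul -mulmxA [Z^T *m _]mulmxA ZZv -scalemxAr vv scale_scalar_mx mulr1.
have a_gt0 : 0 < a.
  rewrite lt_def a0 /=; have /matrixP/(_ 0 0) := vZZv; rewrite [RHS]mxE mulr1n => <-.
  by rewrite mxE; apply: sumr_ge0 => i _; rewrite mxE -expr2 sqr_ge0.
pose b := Num.sqrt a.
have b_gt0 : 0 < b by rewrite sqrtr_gt0.
have b0 : b != 0 by rewrite gt_eqF.
have bb : b * b = a by rewrite -expr2 sqr_sqrtr // ltW.
exists v, (- b^-1 *: (Z *m v)), b; split=> //.
- split=> //.
    rewrite [(_ *: _)^T]linearZ /= -scalemxAl -scalemxAr scalerA vZZv.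
    by rewrite mulrNN scale_scalar_mx -invfM bb mulVf.
  apply: trmx_inj; rewrite trmx0 trmx_mul trmxK [(_ *: _)^T]linearZ /= -scalemxAl.
  rewrite trmx_mul skewZ mulmxN mulNmx scalerN.
  suff -> : v^T *m Z *m v = 0 by rewrite scaler0 oppr0.
  have /matrixP/(_ 0 0) : (v^T *m Z *m v)^T = - (v^T *m Z *m v).
    by rewrite !trmx_mul trmxK skewZ mulNmx mulmxN mulmxA.
  rewrite mxE [RHS]mxE => /eqP; rewrite eq_sym eqNr => /eqP c0.
  by rewrite [LHS]mx11_scalar c0 raddf0.
- by rewrite scalerA mulrNN mulfV // scale1r.
have ZZ : Z *m Z = - (Z^T *m Z) by rewrite skewZ mulNmx opprK.
rewrite -scalemxAr mulmxA ZZ mulNmx scalerN scaleNr opprK.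
by rewrite ZZv scalerA -bb mulrA mulVf ?mul1r.
Qed.

(** Induction on the rank: subtracting from Z its action on the plane of
    [skew_plane] leaves a skew-symmetric matrix of smaller rank that vanishes on
    that plane, so that the basis obtained for it is orthogonal to the plane. *)
Lemma skew_normal_form (n : nat) (Z : 'M[R]_n) : Z^T = - Z ->
  exists (p : nat) (W : 'M[R]_(n, p + p)) (d : 'rV[R]_p),
    [/\ W^T *m W = 1%:M, forall i, 0 < d 0 i & Z = W *m skewdiag_mx d *m W^T].
Proof.
have [r] := ubnP (\rank Z); elim: r Z => // r IHr Z ltZr skewZ.
have [->|Z0] := eqVneq Z 0.
  exists 0%N, 0, 0; split; [by apply/matrixP=> -[]|by case|].
  by rewrite !mul0mx.
have [v [w [b [b0 [vv ww vw] Zv Zw]]]] := skew_plane skewZ Z0.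
have wv : w^T *m v = 0 by apply: trmx_inj; rewrite trmx_mul trmxK vw trmx0.
have vZ : v^T *m Z = b *: w^T.
  by apply: oppr_inj; rewrite -mulmxN -skewZ -trmx_mul Zv linearZ /= scaleNr.
have wZ : w^T *m Z = - b *: v^T.
  by apply: oppr_inj; rewrite -mulmxN -skewZ -trmx_mul Zw linearZ /= scaleNr opprK.
(* Written as a left multiple of Z, the remainder has its row space inside that
   of Z; the inclusion is strict because Z1 kills w and Z does not. *)
pose Z1 := (1%:M - v *m v^T - w *m w^T) *m Z.
have Z1E : Z1 = Z - (b *: (v *m w^T) - b *: (w *m v^T)).
  by rewrite /Z1 !mulmxBl mul1mx -!mulmxA vZ wZ -!scalemxAr scaleNr opprK opprB [RHS]addrA [LHS]addrAC.
have skewZ1 : Z1^T = - Z1.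
  rewrite Z1E !(linearB, linearZ) /= !trmx_mul !trmxK skewZ.
  by rewrite !opprK [X in _ + X]addrC.
have Z1v : Z1 *m v = 0.
  rewrite Z1E !mulmxBl -!scalemxAl -!mulmxA vv wv mulmx0 scaler0 mulmx1 sub0r opprK Zv.
  by rewrite scaleNr addNr.
have Z1w : Z1 *m w = 0.
  rewrite Z1E !mulmxBl -!scalemxAl -!mulmxA ww vw mulmx0 scaler0 mulmx1 subr0 Zw.
  by rewrite subrr.
have ltZ1 : (\rank Z1 < r)%N.
  apply: leq_trans (_ : \rank Z <= r)%N => //; apply: rank_ltmx.
  rewrite ltmxE submxMl; apply/negP => /submxP[G ZE].
  suff /matrixP/(_ 0 0) : b *: w^T *m w = 0.
    by rewrite -scalemxAl ww !mxE mulr1 => b00; rewrite b00 ltxx in b0.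
  by rewrite -vZ -mulmxA ZE -mulmxA Z1w !mulmx0.
have [p [W [d [WW d0 Z1W]]]] := IHr _ ltZ1 skewZ1.
have W0 (u : 'cV_n) : Z1 *m u = 0 -> W^T *m u = 0.
  rewrite Z1W -!mulmxA => /(congr1 (mulmx W^T)); rewrite !mulmxA WW mul1mx mulmx0 -mulmxA.
  by apply: skewdiag_mx_inj => i; rewrite gt_eqF.
have Wv := W0 _ Z1v; have Ww := W0 _ Z1w.
have vW : v^T *m W = 0 by apply: trmx_inj; rewrite trmx_mul trmxK Wv trmx0.
have wW : w^T *m W = 0 by apply: trmx_inj; rewrite trmx_mul trmxK Ww trmx0.
have cross : W^T *m row_mx v w = 0 by rewrite mul_mx_row Wv Ww row_mx0.
have cross' : (row_mx v w)^T *m W = 0 by rewrite tr_row_mx mul_col_mx vW wW col_mx0.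
exists (1 + p)%N, (sconcat (row_mx v w) W), (row_mx b%:M d); split.
- rewrite -(mulmx1 _^T) sconcat_congr ?mulmx1 // WW.
  by rewrite tr_row_mx mul_col_row vv ww vw wv -scalar_mx_block sdsum1.
- move=> i; rewrite mxE; case: splitP => j _ //.
  by rewrite ord1 mxE eqxx mulr1n.
rewrite -sdsum_skewdiag sconcat_outer -Z1W Z1E.
suff <- : b *: (v *m w^T) - b *: (w *m v^T) =
    row_mx v w *m skewdiag_mx b%:M *m (row_mx v w)^T by rewrite addrC subrK.
rewrite /skewdiag_mx; have -> : diag_mx b%:M = b%:M :> 'M[R]_1.
  by rewrite [LHS]mx11_scalar !mxE eqxx !mulr1n.
rewrite tr_row_mx mul_row_block !mulmx0 add0r addr0 mulmxN !mul_mx_scalar mul_row_col.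
by rewrite mulNmx -!scalemxAl addrC.
Qed.
End SkewNormalForm.

(** * Square roots and functions of a symmetric matrix *)

Section SquareRoot.
Variable R : realType.

(** If H = C - C' were nonzero it would have a unit eigenvector v for some a != 0.
    From C H + H C' = C^2 - C'^2 = 0 the nonnegative numbers v^T C v and
    v^T C' v add up to 0, whereas their difference is a. *)
Lemma psd_sqrt_inj (N : nat) (C C' : 'M[R]_N) :
  psd_mx C -> psd_mx C' -> C *m C = C' *m C' -> C = C'.
Proof.
move=> [symC posC] [symC' posC'] CC; apply/eqP; rewrite -subr_eq0; apply/negPn/negP => H0.
have symH : (C - C')^T = C - C' by rewrite linearB /= symC symC'.
have [v [a [vv a0 Hv]]] := symmetric_eigenvector symH H0.
have vH : v^T *m (C - C') = a *: v^T.
  by apply: trmx_inj; rewrite trmx_mul trmxK symH Hv [RHS]linearZ /= trmxK.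
have qE (B : 'M[R]_N) : v^T *m B *m v = (dotv v (B *m v))%:M.
  by rewrite /dotv mulmxA -mx11_scalar.
have sum0 : dotv v (C *m v) + dotv v (C' *m v) = 0.
  apply: (mulfI a0); rewrite mulr0.
  have /matrixP/(_ 0 0) : v^T *m (C *m (C - C') + (C - C') *m C') *m v = 0.
    rewrite mulmxBr mulmxBl CC addrA subrK subrr mulmx0 mul0mx //.
  rewrite mulmxDr mulmxDl !mulmxA vH -!mulmxA Hv -!scalemxAl -!scalemxAr !mulmxA !qE.
  by rewrite !mxE eqxx !mulr1n mulrDr.
have dif : dotv v (C *m v) - dotv v (C' *m v) = a.
  have /matrixP/(_ 0 0) : v^T *m (C - C') *m v = a%:M.
    by rewrite vH -scalemxAl vv scale_scalar_mx mulr1.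
  by rewrite mulmxBr mulmxBl !qE !mxE eqxx !mulr1n.
move: (posC v) (posC' v) sum0 dif => p q /eqP.
by rewrite paddr_eq0 // => /andP[/eqP-> /eqP->] /esym/eqP; rewrite subr0 (negPf a0).
Qed.

Lemma sqrtmx_unique (N : nat) (B C : 'M[R]_N) : psd_mx C -> C *m C = B -> sqrtmx B = C.
Proof.
move=> psdC CC; apply: xget_subset1 => //= D D' [psdD DD] [psdD' DD'].
by apply: psd_sqrt_inj; rewrite // DD DD'.
Qed.

(** Functional calculus: when [V] is orthogonal, this is the symmetric matrix whose
    i-th eigenvector is the i-th column of [V], with eigenvalue [x i]. *)
Definition fun_mx (N : nat) (V : 'M[R]_N) (x : 'I_N -> R) : 'M[R]_N :=
  V *m diag_mx (\row_i x i) *m V^T.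

Lemma fun_mxD N (V : 'M[R]_N) x y : fun_mx V x + fun_mx V y = fun_mx V (fun i => x i + y i).
Proof.
rewrite /fun_mx -mulmxDl -mulmxDr -linearD /=; congr (_ *m diag_mx _ *m _).
by apply/rowP=> i; rewrite !mxE.
Qed.

Lemma fun_mxZ N (V : 'M[R]_N) a x : a *: fun_mx V x = fun_mx V (fun i => a * x i).
Proof.
rewrite /fun_mx scalemxAl scalemxAr -linearZ /=; congr (_ *m diag_mx _ *m _).
by apply/rowP=> i; rewrite !mxE.
Qed.

Lemma eq_fun_mx N (V : 'M[R]_N) x y : x =1 y -> fun_mx V x = fun_mx V y.
Proof. by move=> xy; congr (_ *m diag_mx _ *m _); apply/rowP=> i; rewrite !mxE. Qed.

Lemma fun_mxT N (V : 'M[R]_N) x : (fun_mx V x)^T = fun_mx V x.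
Proof. by rewrite !trmx_mul trmxK tr_diag_mx mulmxA. Qed.

Lemma psd_fun_mx N (V : 'M[R]_N) x : (forall i, 0 <= x i) -> psd_mx (fun_mx V x).
Proof.
move=> x0; split; [exact: fun_mxT | move=> v].
have -> : dotv v (fun_mx V x *m v) = dotv (V^T *m v) (diag_mx (\row_i x i) *m (V^T *m v)).
  by rewrite /dotv trmx_mul trmxK !mulmxA.
rewrite /dotv mul_diag_mx mxE; apply: sumr_ge0 => i _.
by rewrite !mxE mulrCA -expr2 mulr_ge0 ?sqr_ge0.
Qed.

Section Orthogonal.
Variables (N : nat) (V : 'M[R]_N).
Hypothesis VV : V^T *m V = 1%:M.

Lemma fun_mxM x y : fun_mx V x *m fun_mx V y = fun_mx V (fun i => x i * y i).
Proof.
rewrite /fun_mx -!mulmxA [V^T *m (V *m _)]mulmxA VV mul1mx [diag_mx _ *m (_ *m _)]mulmxA.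
rewrite mulmx_diag; congr (_ *m (diag_mx _ *m _)).
by apply/rowP=> i; rewrite !mxE.
Qed.

Lemma fun_mx1 : fun_mx V (fun=> 1) = 1%:M.
Proof.
rewrite /fun_mx; have -> : \row_(i < N) 1 = const_mx 1 :> 'rV[R]_N.
  by apply/rowP=> i; rewrite !mxE.
by rewrite diag_const_mx mulmx1 (mulmx1C VV).
Qed.

Lemma sqrt_fun_mx x : (forall i, 0 <= x i) ->
  sqrtmx (fun_mx V x) = fun_mx V (fun i => Num.sqrt (x i)).
Proof.
move=> x0; apply: sqrtmx_unique; first by apply: psd_fun_mx => i; apply: sqrtr_ge0.
by rewrite fun_mxM; apply: eq_fun_mx => i; rewrite -expr2 sqr_sqrtr.
Qed.

Variable d : 'I_N -> R.

Lemma absmx_fun_mx : absmx (fun_mx V d) = fun_mx V (fun i => `|d i|).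
Proof.
rewrite /absmx fun_mxM sqrt_fun_mx => [|i]; last by rewrite -expr2 sqr_ge0.
by apply: eq_fun_mx => i; rewrite -expr2 sqrtr_sqr.
Qed.

Lemma negmx_fun_mx : negmx (fun_mx V d) = fun_mx V (fun i => if d i < 0 then - d i else 0).
Proof.
rewrite /negmx absmx_fun_mx -scaleN1r fun_mxZ fun_mxD fun_mxZ.
apply: eq_fun_mx => i; rewrite mulN1r; case: ltP => [d0|d0].
  by rewrite ltr0_norm // -mulr2n -[X in _ * X]mulr_natl mulKf ?pnatr_eq0.
by rewrite ger0_norm // subrr mulr0.
Qed.

Lemma posmx_fun_mx : posmx (fun_mx V d) = fun_mx V (fun i => if 0 < d i then d i else 0).
Proof.
rewrite /posmx absmx_fun_mx fun_mxD fun_mxZ.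
apply: eq_fun_mx => i; case: ltP => [d0|d0].
  by rewrite gtr0_norm // -mulr2n -[X in _ * X]mulr_natl mulKf ?pnatr_eq0.
by rewrite ler0_norm // addNr mulr0.
Qed.

Lemma mulmx_fun_mx x : fun_mx V x *m V = V *m diag_mx (\row_i x i).
Proof. by rewrite /fun_mx -!mulmxA VV mulmx1. Qed.

(** The orthogonal projection onto the sum of the eigenspaces whose eigenvalue
    satisfies [s]. *)
Definition eigproj (s : pred R) : 'M[R]_N := fun_mx V (fun i => (s (d i))%:R).

(** The range of [eigproj s] is the least subspace containing the eigenvectors:
    in the coordinates given by V an eigenvector for a is supported on the
    indices where d is a, and the vectors fixed by the projection are
    combinations of the columns of V whose eigenvalue satisfies s. *)
Lemma mem_eig_span (S : set R) (s : pred R) (v : 'cV[R]_N) :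
  (forall a, S a <-> s a) ->
  (v \in eig_span (fun_mx V d) S) = (eigproj s *m v == v).
Proof.
move=> Ss; set A := fun_mx V d; pose P := eigproj s.
pose E := lker (linfun (mulmx (P - 1%:M) : 'cV[R]_N -> 'cV[R]_N)).
have memE u : (u \in E) = (P *m u == u).
  by rewrite memv_ker lfunE /= mulmxBl mul1mx subr_eq0.
have EX u : u != 0 /\ (exists2 a, S a & A *m u = a *: u) -> u \in E.
  move=> [_ [a /Ss sa Au]]; rewrite memE; apply/eqP.
  have dVu i : d i * (V^T *m u) i 0 = a * (V^T *m u) i 0.
    have /colP/(_ i) : V^T *m (A *m u) = a *: (V^T *m u) by rewrite Au -scalemxAr.
    by rewrite /A /fun_mx !mulmxA VV mul1mx -mulmxA mul_diag_mx !mxE.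
  suff -> : u = V *m (diag_mx (\row_i (s (d i))%:R) *m (V^T *m u)).
    by rewrite /P /eigproj /fun_mx -!mulmxA [V^T *m (V *m _)]mulmxA VV mul1mx
      [diag_mx _ *m (diag_mx _ *m _)]mulmxA mulmx_diag; congr (_ *m (diag_mx _ *m _));
      apply/rowP=> i; rewrite !mxE -natrM mulnb andbb.
  rewrite -[LHS]mul1mx -(mulmx1C VV) -mulmxA; congr (_ *m _).
  have := dVu; move: (V^T *m u) => y dy; apply/colP=> i; rewrite mul_diag_mx 2!mxE.
  have [->|y0] := eqVneq (y i 0) 0; first by rewrite mulr0.
  by rewrite (mulIf y0 (dy i)) sa mul1r.
have Emin (E' : {vspace 'cV[R]_N}) :
    (forall u, u != 0 /\ (exists2 a, S a & A *m u = a *: u) -> u \in E') -> (E <= E')%VS.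
  move=> E'X; apply/subvP=> u; rewrite memE => /eqP <-.
  have -> : P *m u = \sum_i ((s (d i))%:R * (V^T *m u) i 0) *: col i V.
    apply/colP=> j; rewrite summxE /P /eigproj /fun_mx -!mulmxA mul_diag_mx mxE.
    by apply: eq_bigr => i _; rewrite !mxE mulrC.
  apply: memv_suml => i _; have [sd|_] := boolP (s (d i)); last by rewrite mul0r scale0r mem0v.
  have [->|V0] := eqVneq (col i V) 0; first by rewrite scaler0 mem0v.
  apply/memvZ/E'X; split=> //; exists (d i); first exact/Ss.
  by rewrite colE mulmxA mulmx_fun_mx -!colE; apply/colP=> j; rewrite mul_mx_diag !mxE mulrC.
rewrite -memE; suff -> : eig_span A S = E by [].
apply: xget_subset1; first by [].
move=> W W' [WX Wmin] [W'X W'min]; apply/eqP; rewrite eqEsubv.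
by rewrite Wmin // W'min.
Qed.

End Orthogonal.

Lemma dim_orthonormal (N r : nat) (E : {vspace 'cV[R]_N}) (Q : 'M[R]_(N, r)) :
  Q^T *m Q = 1%:M -> (forall v, (v \in E) = (Q *m Q^T *m v == v)) -> \dim E = r.
Proof.
move=> QQ memE; pose f := linfun (mulmx Q : 'cV[R]_r -> 'cV[R]_N).
have -> : E = (f @: fullv)%VS.
  apply/vspaceP=> v; rewrite memE; apply/eqP/memv_imgP => [<-|[u _ ->]].
    by exists (Q^T *m v); rewrite ?memvf // lfunE /= mulmxA.
  by rewrite lfunE /= !mulmxA -(mulmxA Q) QQ mulmx1.
have f0 : (fullv :&: lker f = 0)%VS.
  apply/eqP; rewrite -subv0; apply/subvP => u; rewrite memv_cap memv_ker => /andP[_].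
  rewrite lfunE /= memv0 => /eqP /(congr1 (mulmx Q^T)).
  by rewrite mulmxA QQ mul1mx mulmx0 => ->.
by rewrite (limg_dim_eq f0) dimvf; apply: muln1.
Qed.

Lemma eigproj_orthonormal_basis (N : nat) (V : 'M[R]_N) (d : 'I_N -> R) (s : pred R) :
  V^T *m V = 1%:M ->
  exists (r : nat) (Q : 'M[R]_(N, r)), Q^T *m Q = 1%:M /\ Q *m Q^T = eigproj V d s.
Proof.
move=> VV; pose T := [pred i | s (d i)].
exists #|T|, (colsub (fun j : 'I_#|T| => enum_val j) V); split.
  apply/matrixP=> i j; have /matrixP/(_ (enum_val i) (enum_val j)) := VV.
  rewrite !mxE (inj_eq enum_val_inj) => <-.
  by apply: eq_bigr => k _; rewrite !mxE.
apply/matrixP=> i j; rewrite /eigproj /fun_mx mul_mx_diag !mxE.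
under eq_bigr do rewrite !mxE.
under [RHS]eq_bigr do rewrite !mxE mulrAC.
rewrite -(big_enum_val (fun k => V i k * V j k)) [LHS]big_mkcond; apply: eq_bigr => k _.
by rewrite inE; case: (s (d k)); rewrite ?mulr1 ?mulr0.
Qed.
End SquareRoot.

(** * The symplectic basis of one eigenspace *)

Section OneSign.
Variable R : realType.

Lemma skewdiagT p (x : 'rV[R]_p) : (skewdiag_mx x)^T = - skewdiag_mx x.
Proof.
by rewrite /skewdiag_mx tr_block_mx opp_block_mx linearN /= tr_diag_mx !trmx0 oppr0 opprK.
Qed.

Definition dbl_fam p (x : 'I_p -> R) : 'M[R]_(p + p) :=
  dsum (diag_mx (\row_i x i)) (diag_mx (\row_i x i)).

Definition skew_fam p (x : 'I_p -> R) : 'M[R]_(p + p) := skewdiag_mx (\row_i x i).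

Let mulE p (x y : 'I_p -> R) :
  diag_mx (\row_i x i) *m diag_mx (\row_i y i) = diag_mx (\row_i (x i * y i)).
Proof. by rewrite mulmx_diag; congr diag_mx; apply/rowP=> i; rewrite !mxE. Qed.

Lemma skew_fam_mul p (x y : 'I_p -> R) : skew_fam x *m skew_fam y = - dbl_fam (fun i => x i * y i).
Proof.
rewrite /skew_fam /skewdiag_mx mulmx_block !(mulmx0, mul0mx, addr0, add0r) mulmxN mulNmx mulE.
by rewrite /dbl_fam /dsum opp_block_mx oppr0.
Qed.

Lemma dbl_skew_fam p (x y : 'I_p -> R) : dbl_fam x *m skew_fam y = skew_fam (fun i => x i * y i).
Proof.
by rewrite /skew_fam /skewdiag_mx /dbl_fam /dsum mulmx_block !(mulmx0, mul0mx, addr0, add0r) mulmxN mulE.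
Qed.

Lemma dbl_fam_mul p (x y : 'I_p -> R) : dbl_fam x *m dbl_fam y = dbl_fam (fun i => x i * y i).
Proof. by rewrite /dbl_fam /dsum mulmx_block !(mulmx0, mul0mx, addr0, add0r) mulE. Qed.

Lemma JmxT n : (Jmx n)^T = - Jmx n :> 'M[R]_(n + n).
Proof. by rewrite Jmx_skewdiag skewdiagT. Qed.

Lemma Jmx_skew_fam n : Jmx n = skew_fam (fun=> 1) :> 'M[R]_(n + n).
Proof. by rewrite Jmx_skewdiag; congr skewdiag_mx; apply/rowP=> i; rewrite !mxE. Qed.

Lemma JmxJ n : Jmx n *m Jmx n = - 1%:M :> 'M[R]_(n + n).
Proof.
by rewrite /Jmx mulmx_block !(mulmx0, mul0mx, addr0, add0r) mulmxN mulNmx mulmx1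
  [in RHS]scalar_mx_block opp_block_mx oppr0.
Qed.

Lemma invmx_sqrtmx_diag p (x : 'I_p -> R) : (forall i, 0 < x i) ->
  invmx (sqrtmx (diag_mx (\row_i x i))) = diag_mx (\row_i (Num.sqrt (x i))^-1).
Proof.
move=> x0; have fE y : fun_mx 1%:M y = diag_mx (\row_(i < p) y i) :> 'M[R]_p.
  by rewrite /fun_mx mul1mx trmx1 mulmx1.
rewrite -fE sqrt_fun_mx ?trmx1 ?mulmx1 // => [|i]; last exact: ltW.
set B := fun_mx _ _; set C := diag_mx _.
have BC : B *m C = 1%:M.
  rewrite /B fE mulE -diag_const_mx; congr diag_mx; apply/rowP=> i.
  by rewrite !mxE mulfV // gt_eqF // sqrtr_gt0.
have [Bu _] := mulmx1_unit BC.
by rewrite -[LHS]mulmx1 -BC mulmxA mulVmx // mul1mx.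
Qed.

Section Range.
Variables (n : nat) (S P : 'M[R]_(n + n)).
Let J : 'M[R]_(n + n) := Jmx n.
Hypothesis symS : S^T = S.
Hypothesis PS : P *m S = S.
Hypothesis PJ : P *m J = J *m P.

(** [G] is the inverse of S on the range E of P. Since J preserves E, the
    matrix S J S is invertible there, with inverse - G J G, and it vanishes on
    the orthogonal complement; the basis W of its normal form therefore spans E. *)
Lemma skew_range_form (G : 'M[R]_(n + n)) (E : {vspace 'cV[R]_(n + n)}) (k : nat) :
  P^T = P -> S *m G = P -> G *m S = P ->
  (forall v, (v \in E) = (P *m v == v)) -> \dim E = k.*2 ->
  exists (W : 'M[R]_(n + n, k + k)) (d : 'I_k -> R),
    [/\ forall i, 0 < d i, W^T *m W = 1%:M, W *m W^T = P &
        S *m J *m S = W *m skew_fam d *m W^T].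
Proof.
move=> symP SG GS memE dimE.
have PP : P *m P = P by rewrite -{2}SG mulmxA PS.
have SP : S *m P = S by apply: trmx_inj; rewrite trmx_mul symP symS PS.
have skewZ : (S *m J *m S)^T = - (S *m J *m S).
  by rewrite !trmx_mul symS JmxT mulNmx mulmxN mulmxA.
have [p [W [d [WW d0 ZE]]]] := skew_normal_form skewZ.
have ZG : S *m J *m S *m (G *m J *m G) = - P.
  rewrite !mulmxA -[_ *m S *m G]mulmxA SG -[_ *m P *m J]mulmxA PJ mulmxA.
  rewrite -[S *m J *m J]mulmxA JmxJ mulmxN mulmx1 !mulNmx SP SG //.
(* The columns of W lie in the range of P: cancel the injective middle factor in
   P W K = W K. *)
have PW : P *m W = W.
  have /(congr1 (mulmx P)) := ZE; rewrite !mulmxA PS => /esym.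
  rewrite ZE => /(congr1 (mulmxr W)) /=; rewrite -!mulmxA WW mulmx1 !mulmxA => H.
  have {}H : (P *m W - W) *m skewdiag_mx d = 0 by rewrite mulmxBl H subrr.
  apply/eqP; rewrite -subr_eq0; apply/eqP/trmx_inj; rewrite trmx0.
  apply: (@skewdiag_mx_inj _ _ _ d) => [i|]; first by rewrite gt_eqF.
  by apply: oppr_inj; rewrite oppr0 -mulNmx -skewdiagT -trmx_mul H trmx0.
have WP : W^T *m P = W^T by apply: trmx_inj; rewrite trmx_mul trmxK symP PW.
have WWP : W *m W^T = P.
  apply: oppr_inj; rewrite -ZG ZE.
  have -> : W *m skewdiag_mx d *m W^T *m (G *m J *m G) =
      W *m W^T *m (W *m skewdiag_mx d *m W^T *m (G *m J *m G)).
    by rewrite !mulmxA -[W *m W^T *m W]mulmxA WW mulmx1.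
  by rewrite -ZE ZG mulmxN -mulmxA WP.
have dimW : \dim E = (p + p)%N by apply: (dim_orthonormal WW) => v; rewrite WWP memE.
have kp : k = p by apply: double_inj; rewrite -dimE dimW addnn.
rewrite kp; exists W, (d 0); split=> //.
by rewrite ZE /skew_fam; congr (_ *m skewdiag_mx _ *m _); apply/rowP=> i; rewrite mxE.
Qed.

Variables (k : nat) (W : 'M[R]_(n + n, k + k)) (d : 'I_k -> R).
Hypothesis d0 : forall i, 0 < d i.
Hypothesis WW : W^T *m W = 1%:M.
Hypothesis ZE : S *m J *m S = W *m skew_fam d *m W^T.

(** The part of the symplectic basis that comes from one sign of the eigenvalues. *)
Definition williamson_cols : 'M[R]_(n + n, k + k) :=
  let D := invmx (sqrtmx (diag_mx (\row_i d i))) in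
  J *m S *m W *m dsum D D *m (Jmx k)^T.

Lemma williamson_colsE :
  williamson_cols = - (J *m S *m W *m skew_fam (fun i => (Num.sqrt (d i))^-1)).
Proof.
rewrite /williamson_cols invmx_sqrtmx_diag // JmxT mulmxN.
rewrite -[dsum _ _]/(dbl_fam (fun i => (Num.sqrt (d i))^-1)) (Jmx_skew_fam k)
  -[_ *m dbl_fam _ *m _]mulmxA dbl_skew_fam.
by congr (- (_ *m skewdiag_mx _)); apply/rowP=> i; rewrite !mxE mulr1.
Qed.

Let t i : R := (Num.sqrt (d i))^-1.

Let ttd i : t i * d i * t i = 1.
Proof.
rewrite /t -{2}[d i]sqr_sqrtr ?ltW // expr2 mulrA mulVf ?mul1r ?mulfV //;
by rewrite gt_eqF // sqrtr_gt0.
Qed.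

Lemma williamson_colsT : williamson_cols^T = - (skew_fam t *m W^T *m S *m J).
Proof.
rewrite williamson_colsE linearN /= !trmx_mul symS JmxT skewdiagT.
by rewrite !mulmxN !mulNmx opprK !mulmxA.
Qed.

Let ZW : S *m J *m S *m W = W *m skew_fam d.
Proof. by rewrite ZE -mulmxA WW mulmx1. Qed.

(** Let T and K be the skew matrices of the families d_i^(-1/2) and d_i. Then the
    left-hand side is - T (W^T S J S W) T = - T K T, and T K T = - J. *)
Lemma williamson_cols_J : williamson_cols^T *m J *m williamson_cols = Jmx k.
Proof.
rewrite williamson_colsT williamson_colsE mulNmx mulmxN mulNmx opprK -/t.
rewrite !mulmxA -[_ *m J *m J]mulmxA JmxJ mulmxN mulmx1 !mulNmx.
rewrite -[_ *m S *m J]mulmxA -[_ *m (S *m J) *m S]mulmxA -[_ *m (S *m J *m S) *m W]mulmxA ZW.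
rewrite mulmxA -[_ *m W^T *m W]mulmxA WW mulmx1 skew_fam_mul mulNmx opprK dbl_skew_fam Jmx_skew_fam.
by congr skewdiag_mx; apply/rowP=> i; rewrite !mxE ttd.
Qed.

Lemma williamson_cols_sq : williamson_cols^T *m (S *m S) *m williamson_cols = dbl_fam d.
Proof.
rewrite williamson_colsT williamson_colsE mulNmx mulmxN mulNmx opprK -/t.
have -> : skew_fam t *m W^T *m S *m J *m (S *m S) *m (J *m S *m W *m skew_fam t) =
    skew_fam t *m W^T *m (S *m J *m S) *m (S *m J *m S *m W) *m skew_fam t by rewrite !mulmxA.
rewrite ZW {1}ZE !mulmxA -[_ *m W^T *m W]mulmxA WW mulmx1 -[_ *m W^T *m W]mulmxA WW mulmx1.
rewrite skew_fam_mul -mulmxA skew_fam_mul mulmxN mulNmx opprK dbl_fam_mul.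
by congr dsum; congr diag_mx; apply/rowP=> i; rewrite !mxE mulrCA ttd mulr1.
Qed.

Lemma williamson_cols_range : P *m williamson_cols = williamson_cols.
Proof. by rewrite williamson_colsE mulmxN !mulmxA PJ -[J *m P *m S]mulmxA PS. Qed.
End Range.
End OneSign.

(** * Alternating the two halves of a symplectic basis *)

Section Shuffle.
Variable R : realType.

Lemma half_lt n (r : 'I_(n + n)) : (r./2 < n)%N.
Proof. by rewrite ltn_half_double -addnn. Qed.

(** Position of index r once the even indices have been moved, in order, in front
    of the odd ones. *)
Definition unshuffle n (r : 'I_(n + n)) : 'I_(n + n) :=
  if odd r then rshift n (Ordinal (half_lt r)) else lshift n (Ordinal (half_lt r)).

Lemma unshuffle_inj n : injective (@unshuffle n).
Proof.
move=> r s; rewrite /unshuffle => rs; apply: val_inj => /=.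
rewrite -[LHS]odd_double_half -[RHS]odd_double_half.
move: rs; case: (odd r); case: (odd s) => /(congr1 val) /=.
- by move/addnI->.
- by move=> E; have := half_lt s; rewrite -E ltnNge leq_addr.
- by move=> E; have := half_lt r; rewrite E ltnNge leq_addr.
by move->.
Qed.

Lemma PmxE n : Pmx n = \matrix_(r, c) (unshuffle r == c)%:R :> 'M[R]_(n + n).
Proof.
apply/matrixP=> r c; rewrite mxE [RHS]mxE /unshuffle.
have [half_r r_half] := (half_lt r, odd_double_half r).
case: splitP => c' cE; rewrite mxE; congr (nat_of_bool _)%:R;
  rewrite -(inj_eq val_inj) /= cE; move: r_half; case: (odd r) => /= r_half.
- rewrite -r_half addSn add0n; apply/eqP/eqP => E.
    by have := odd_double c'; rewrite -E /= odd_double.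
  by have := ltn_ord c'; rewrite -E ltnNge leq_addr.
- by rewrite -{1}r_half add0n (inj_eq double_inj).
- by rewrite -{1}r_half add1n eqSS (inj_eq double_inj) eqn_add2l.
rewrite -{1}r_half add0n; apply/eqP/eqP => E.
  by have := odd_double r./2; rewrite E /= odd_double.
by have := half_r; rewrite E ltnNge leq_addr.
Qed.

Lemma Pmx_mul n (Z : 'M[R]_(n + n)) : Pmx n *m Z = rowsub (@unshuffle n) Z.
Proof.
rewrite PmxE; apply/matrixP=> r s; rewrite !mxE (bigD1 (unshuffle r)) //= !mxE eqxx mul1r.
rewrite big1 ?addr0 // => c /negbTE cs.
by rewrite mxE eq_sym cs mul0r.
Qed.

Lemma Pmx_congr n (Z : 'M[R]_(n + n)) :
  Pmx n *m Z *m (Pmx n)^T = mxsub (@unshuffle n) (@unshuffle n) Z.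
Proof.
apply: trmx_inj; rewrite trmx_mul trmxK !Pmx_mul.
by apply/matrixP=> r s; rewrite !mxE.
Qed.

Lemma PmxK n : (Pmx n)^T *m Pmx n = 1%:M :> 'M[R]_(n + n).
Proof.
apply: mulmx1C; rewrite -[X in X *m _]mulmx1 Pmx_congr; apply/matrixP=> r s.
by rewrite !mxE (inj_eq (@unshuffle_inj n)).
Qed.

(** [tagnat.Rank i a] is the position of the a-th row of the i-th block. *)
Lemma mxdiagE (p : nat) (B : 'I_p -> 'M[R]_2) i a j b :
  (\mxdiag_(i < p) B i) (@tagnat.Rank _ (fun=> 2%N) i a) (@tagnat.Rank _ (fun=> 2%N) j b) =
  if i == j then B i a b else 0.
Proof.
have /matrixP/(_ a b) := @mxblockK R p p (fun=> 2%N) (fun=> 2%N)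
  (fun j k : 'I_p => if j == k then conform_mx 0 (B j) else 0) i j.
rewrite [LHS]mxE => ->; case: eqP => [_|]; last by rewrite mxE.
by rewrite conform_mx_id.
Qed.

Lemma Rank2E p (i : 'I_p) (a : 'I_2) : @tagnat.Rank _ (fun=> 2%N) i a = (i.*2 + a)%N :> nat.
Proof.
by rewrite tagnat.RankEsum (big_ord_narrow (ltnW (ltn_ord i))) sum_nat_const card_ord muln2.
Qed.

Lemma skew2E (b : R) (i j : 'I_2) :
  skew2 b i j = if odd i == odd j then 0 else if odd i then - b else b.
Proof.
move: i j; rewrite /skew2.
suff E (p q : 'I_(1 + 1)) : (block_mx 0 b%:M (- b%:M) 0 : 'M[R]_(1 + 1)) p q =
    if odd p == odd q then 0 else if odd p then - b else b by [].
rewrite -[p]splitK -[q]splitK; case: (split p) => p'; case: (split q) => q';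
  by rewrite /= ?(block_mxEul, block_mxEur, block_mxEdl, block_mxEdr) !ord1 !mxE.
Qed.

Lemma unshuffle_skewE n (x : 'rV[R]_n) (r s : 'I_(n + n)) :
  mxsub (@unshuffle n) (@unshuffle n) (skewdiag_mx x) r s =
  if (odd r == odd s) || (r./2 != s./2) then 0
  else (if odd r then -1 else 1) * x 0 (Ordinal (half_lt r)).
Proof.
rewrite mxE /unshuffle /skewdiag_mx.
case: (odd r); case: (odd s); rewrite /= ?(block_mxEul, block_mxEur, block_mxEdl, block_mxEdr) !mxE //;
 rewrite -(inj_eq val_inj) /=; case: eqP => _ //=; rewrite ?mulr1n ?mulr0n ?oppr0 ?mulN1r ?mul1r //.
Qed.

(** Alternating the two halves of the basis turns the matrix with rows (0, D) and
    (-D, 0) into the direct sum of its 2 x 2 blocks. The l zeros in front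
    of b account for the zero block of size 2l. *)
Lemma skew_blocksE (k l m : nat) (e : (k + l + m)%N = (l + (k + m))%N) (b : 'rV[R]_(k + m)) :
  skew_blocks e (b 0) =
  mxsub (@unshuffle _) (@unshuffle _) (skewdiag_mx (row_mx (0 : 'rV_l) b)).
Proof.
rewrite /skew_blocks; apply/matrixP=> r s; rewrite castmxE unshuffle_skewE.
have x0 : (r < l + l)%N -> row_mx (0 : 'rV_l) b 0 (Ordinal (half_lt r)) = 0.
  move=> rl; rewrite mxE; case: splitP => [q _|q /= qE]; first by rewrite mxE.
  have : (r./2 < l)%N by rewrite ltn_half_double -addnn.
  by rewrite qE ltnNge leq_addr.
have xS (i : 'I_(k + m)) : r./2 = (l + i)%N ->
    row_mx (0 : 'rV_l) b 0 (Ordinal (half_lt r)) = b 0 i.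
  move=> ri; rewrite mxE; case: splitP => [q /= qE|q /= qE].
    by have := ltn_ord q; rewrite -qE ri ltnNge leq_addr.
  by congr (b 0 _); apply: val_inj; apply: (@addnI l); rewrite -ri -qE.
have blockE (t : 'I_(l + (k + m) + (l + (k + m)))) (i : 'I_(k + m)) (a : 'I_2) :
    t = (l + l + (i.*2 + a))%N :> nat -> odd t = odd a /\ t./2 = (l + i)%N.
  move=> ->; rewrite addnn addnA -doubleD; split; first by rewrite oddD odd_double.
  by rewrite addnC halfD odd_double andbF add0n half_double; case: a => -[|[|]].
rewrite /dsum /block_mx mxE; case: splitP => a /= ra; rewrite mxE; case: splitP => c /= sc.
- by rewrite mxE x0 ?mulr0 ?if_same // ra.
- by rewrite mxE x0 ?mulr0 ?if_same // ra.
- rewrite mxE ifT //; apply/orP; right; rewrite neq_ltn; apply/orP; right.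
  apply: (@leq_trans l); first by rewrite ltn_half_double -addnn sc.
  by rewrite geq_half_double -addnn ra leq_addr.
move: ra sc; rewrite -[a]tagnat.sig2K -[c]tagnat.sig2K mxdiagE !Rank2E.
move: (tagnat.sig1 a) (tagnat.sig2 a) (tagnat.sig1 c) (tagnat.sig2 c) => /= i a' j c' ra sc.
have [ro rh] := blockE _ _ _ ra; have [so sh] := blockE _ _ _ sc.
rewrite (xS i rh) ro so rh sh eqn_add2l skew2E (inj_eq val_inj).
have [_|_] := eqVneq i j; last by rewrite orbT.
by rewrite orbF; case: ifP => // _; case: ifP; rewrite ?mulN1r ?mul1r.
Qed.

End Shuffle.

(** * Splitting along projections, and reindexing *)

Section Assembly.
Variable R : realType.

Lemma mul_sconcat (N N' p q : nat) (X : 'M[R]_(N', N)) (M : 'M[R]_(N, p + p))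
    (M' : 'M[R]_(N, q + q)) :
  X *m sconcat M M' = sconcat (X *m M) (X *m M').
Proof.
rewrite /sconcat !mul_mx_row -[in RHS](hsubmxK M) -[in RHS](hsubmxK M') !mul_mx_row.
by rewrite !(row_mxKl, row_mxKr).
Qed.

Lemma sconcat0 (N p q : nat) : sconcat (0 : 'M[R]_(N, p + p)) (0 : 'M_(N, q + q)) = 0.
Proof. by rewrite /sconcat !linear0 !row_mx0. Qed.

Lemma sconcat_split (N p q : nat) (P Z : 'M[R]_N) (M : 'M[R]_(N, p + p))
    (M' : 'M[R]_(N, q + q)) :
  P^T = P -> P *m Z = Z *m P -> P *m M = M -> P *m M' = 0 ->
  (sconcat M M')^T *m Z *m sconcat M M' = sdsum (M^T *m Z *m M) (M'^T *m Z *m M').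
Proof.
move=> symP PZ PM PM'; apply: sconcat_congr.
  by rewrite -PM trmx_mul symP -[_ *m P *m Z]mulmxA PZ -!mulmxA PM' !mulmx0.
by rewrite -PM -!mulmxA [Z *m _]mulmxA -PZ -mulmxA [M'^T *m _]mulmxA -symP -trmx_mul PM' trmx0 mul0mx.
Qed.

Lemma sum_Jmx p q : sdsum (Jmx p) (Jmx q) = Jmx (p + q) :> 'M[R]_((p + q) + (p + q)).
Proof. by rewrite !Jmx_skewdiag sdsum_skewdiag row_mx_const. Qed.

Lemma congr_castmx (N a b : nat) (h : a = b) (M : 'M[R]_(N, a)) (Z : 'M[R]_N) :
  (castmx (erefl, h) M)^T *m Z *m castmx (erefl, h) M = castmx (h, h) (M^T *m Z *m M).
Proof. by case: _ / h; rewrite !castmx_id. Qed.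

Lemma castmx_Jmx (a n : nat) (h : (a + a = n + n)%N) : castmx (h, h) (Jmx a) = Jmx n :> 'M[R]_(n + n).
Proof.
have an : a = n by apply: double_inj; rewrite -!addnn.
by case: _ / an h => h; rewrite (eq_irrelevance h erefl) castmx_id.
Qed.

Lemma castmx_dsum (a n : nat) (h : (a + a = n + n)%N) (an : a = n) (X : 'M[R]_a) :
  castmx (h, h) (dsum X X) = dsum (castmx (an, an) X) (castmx (an, an) X).
Proof. by case: _ / an h => h; rewrite (eq_irrelevance h erefl) !castmx_id. Qed.

(** The permutation that reorders the diagonal of D: the statement lists the
    eigenvalues as negative, zero, positive, whereas the concatenation has the
    zero block first. *)
Definition swap_blocks (k l m : nat) (i : 'I_(l + k + m)) : 'I_(k + l + m) :=
  match split i with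
  | inl i' => lshift m (match split i' with inl a => rshift k a | inr b => lshift l b end)
  | inr c => rshift (k + l) c
  end.

Lemma swap_blocksK k l m : cancel (@swap_blocks k l m) (@swap_blocks l k m).
Proof.
rewrite /swap_blocks => i; rewrite -[RHS]splitK.
case: (split i) => [i'|c] /=; last by rewrite (unsplitK (inr _ c)).
rewrite (unsplitK (inl _ _)) -[RHS](congr1 (lshift m) (splitK i')).
by case: (split i') => a /=; rewrite ?(unsplitK (inl _ a)) ?(unsplitK (inr _ a)).
Qed.

Lemma swap_blocks_dsum k l m (X : 'M[R]_k) (Y : 'M[R]_l) (Z : 'M[R]_m) :
  mxsub (@swap_blocks k l m) (@swap_blocks k l m) (dsum (dsum X Y) Z) = dsum (dsum Y X) Z.
Proof.
have swl a : swap_blocks (lshift m (lshift k a)) = lshift m (rshift k a) :> 'I_(k + l + m).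
  by rewrite /swap_blocks !(unsplitK (inl _ _)).
have swr a : swap_blocks (lshift m (rshift l a)) = lshift m (lshift l a) :> 'I_(k + l + m).
  by rewrite /swap_blocks (unsplitK (inl _ _)) (unsplitK (inr _ _)).
have swz a : swap_blocks (rshift (l + k) a) = rshift (k + l) a :> 'I_(k + l + m).
  by rewrite /swap_blocks (unsplitK (inr _ _)).
apply/matrixP=> r c; rewrite mxE /dsum.
have [r' ->|r' ->] := split_ordP r; have [c' ->|c' ->] := split_ordP c.
- have [a ->|a ->] := split_ordP r'; have [b ->|b ->] := split_ordP c';
    by rewrite ?swl ?swr !(block_mxEul, block_mxEur, block_mxEdl, block_mxEdr) // !mxE.
- have [a ->|a ->] := split_ordP r';
    by rewrite ?swl ?swr swz !(block_mxEur) !mxE.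
- have [b ->|b ->] := split_ordP c';
    by rewrite ?swl ?swr swz !(block_mxEdl) !mxE.
by rewrite !swz !block_mxEdr.
Qed.

Lemma swap_blocks_perm (k l m n : nat) (e : (k + l + m)%N = n) (e' : (l + k + m)%N = n)
    (X : 'M[R]_k) (Y : 'M[R]_l) (Z : 'M[R]_m) :
  exists s : 'S_n, castmx (e', e') (dsum (dsum Y X) Z) =
    mxsub s s (castmx (e, e) (dsum (dsum X Y) Z)).
Proof.
case: _ / e e' => e'; rewrite castmx_id.
pose f i := @swap_blocks k l m (cast_ord (esym e') i).
have f_inj : injective f.
  by move=> i j /(can_inj (@swap_blocksK k l m)) /cast_ord_inj.
exists (perm f_inj); rewrite -swap_blocks_dsum.
by apply/matrixP=> i j; rewrite castmxE [RHS]mxE !permE mxE.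
Qed.

Lemma mul_Pimx (n l p q : nat) (M : 'M[R]_(n + n)) (idx : 'I_q -> 'I_p)
    (f : 'I_q -> 'I_n) :
  (forall a, f a = (l + idx a)%N :> nat) ->
  M *m Pimx n l idx =
    row_mx (colsub (fun a => lshift n (f a)) M) (colsub (fun a => rshift n (f a)) M).
Proof.
move=> fE; have unitE (g : 'I_q -> 'I_(n + n)) (h : 'I_q -> nat) :
    (forall a, g a = h a :> nat) -> M *m unit_cols R (n + n) h = colsub g M.
  move=> gh; apply/matrixP=> r c; rewrite !mxE (bigD1 (g c)) //= mxE gh eqxx mulr1.
  rewrite big1 ?addr0 // => i ig; rewrite mxE -gh (inj_eq val_inj) (negPf ig) mulr0 //.
rewrite /Pimx mul_mx_row; congr row_mx; apply: unitE => a /=; first exact: fE.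
by rewrite fE addnA.
Qed.

Section SconcatPimx.
Variables (k l m : nat).
Let n := (l + (k + m))%N.
Variables (Q : 'M[R]_(n + n, l + l)) (M : 'M[R]_(n + n, k + k)) (M' : 'M[R]_(n + n, m + m)).

Lemma sconcat_Pimxl : sconcat Q (sconcat M M') *m Pimx n l (@lshift k m) = M.
Proof.
rewrite (@mul_Pimx _ _ _ _ _ _ (fun a => rshift l (lshift m a))) // -[RHS]hsubmxK.
by congr row_mx; apply/matrixP=> x a;
  rewrite mxE /sconcat !(row_mxEl, row_mxEr) !(row_mxKl, row_mxKr) !(row_mxEl, row_mxEr).
Qed.

Lemma sconcat_Pimxr : sconcat Q (sconcat M M') *m Pimx n l (@rshift k m) = M'.
Proof.
rewrite (@mul_Pimx _ _ _ _ _ _ (fun a => rshift l (rshift k a))) // -[RHS]hsubmxK.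
by congr row_mx; apply/matrixP=> x a;
  rewrite mxE /sconcat !(row_mxEl, row_mxEr) !(row_mxKl, row_mxKr) !(row_mxEl, row_mxEr).
Qed.
End SconcatPimx.

(** Symplectic orthogonality of two ranges, tested on the columns of the
    projections. *)
Lemma sorth_proj (n : nat) (E F : {vspace 'cV[R]_(n + n)}) (P Q : 'M[R]_(n + n)) :
  (forall v, (v \in E) = (P *m v == v)) -> (forall v, (v \in F) = (Q *m v == v)) ->
  P *m P = P -> Q *m Q = Q -> P^T = P -> Q^T = Q -> symplectically_orthogonal E F ->
  Q *m Jmx n *m P = 0 /\ P *m Jmx n *m Q = 0.
Proof.
move=> memE memF PP QQ symP symQ EF.
have QJP : Q *m Jmx n *m P = 0.
  apply/matrixP=> i j; rewrite [RHS]mxE.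
  have Fi : col i Q \in F by rewrite memF colE mulmxA QQ.
  have Ej : col j P \in E by rewrite memE colE mulmxA PP.
  have := EF _ Fi _ Ej; rewrite !colE.
  rewrite /dotv trmx_mul symQ trmx_delta !mulmxA -rowE => <-.
  by rewrite -!row_mul -colE !mxE.
split=> //; apply: trmx_inj; rewrite !trmx_mul symP symQ JmxT trmx0.
by rewrite mulNmx mulmxN mulmxA QJP oppr0.
Qed.

(** The relations not listed among those of a symplectic basis follow from the
    skew symmetry of J. *)
Lemma symplectic_basis_gram (n l : nat) (E : {vspace 'cV[R]_(n + n)}) (M : 'M[R]_(n + n, l + l)) :
  symplectic_basis E M -> M^T *m Jmx n *m M = Jmx l.
Proof.
move=> [_ H].
have dotE i j : (M^T *m Jmx n *m M) i j = dotv (col i M) (Jmx n *m col j M).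
  by rewrite /dotv tr_col mulmxA -row_mul colE mulmxA -row_mul -colE !mxE.
have skew i j : (M^T *m Jmx n *m M) i j = - (M^T *m Jmx n *m M) j i.
  have : (M^T *m Jmx n *m M)^T = - (M^T *m Jmx n *m M).
    by rewrite !trmx_mul trmxK JmxT mulNmx mulmxN mulmxA.
  by move=> /matrixP/(_ j i); rewrite mxE => ->; rewrite mxE.
apply/matrixP=> i j; rewrite {2}/Jmx.
have [a ->|a ->] := split_ordP i; have [b ->|b ->] := split_ordP j.
- by have [_ uu _] := H a b; rewrite dotE uu block_mxEul mxE.
- by have [uv _ _] := H a b; rewrite dotE uv block_mxEur mxE.
- by have [uv _ _] := H b a; rewrite skew dotE uv block_mxEdl !mxE eq_sym.
by have [_ _ vv] := H a b; rewrite dotE vv block_mxEdr mxE.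
Qed.

Lemma symplectic_basis_fixed (n l : nat) (E : {vspace 'cV[R]_(n + n)}) (P : 'M[R]_(n + n))
    (M : 'M[R]_(n + n, l + l)) :
  (forall v, (v \in E) = (P *m v == v)) -> symplectic_basis E M -> P *m M = M.
Proof.
move=> memE [bE _]; apply/matrixP=> i j.
have : col j M \in E.
  by rewrite -(span_basis bE) memv_span //; apply/mapP; exists j; rewrite ?mem_enum.
by rewrite memE colE mulmxA -!colE => /eqP /colP /(_ i); rewrite !mxE.
Qed.

End Assembly.

(** * The projections onto the eigenspaces *)

Section SpectralPart.
Variable R : realType.
Variables (n : nat) (V : 'M[R]_(n + n)) (d : 'I_(n + n) -> R).
Hypothesis VV : V^T *m V = 1%:M.

Lemma eigproj_idem s : eigproj V d s *m eigproj V d s = eigproj V d s.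
Proof. by rewrite fun_mxM //; apply: eq_fun_mx => i; rewrite -natrM mulnb andbb. Qed.

Lemma fun_mx0 : fun_mx V (fun=> 0) = 0.
Proof.
rewrite /fun_mx; have -> : \row_(i < n + n) 0 = 0 :> 'rV[R]_(n + n).
  by apply/rowP=> i; rewrite !mxE.
by rewrite linear0 mulmx0 mul0mx.
Qed.

Lemma eigproj_orth (s1 s2 : pred R) : (forall a, ~~ (s1 a && s2 a)) ->
  eigproj V d s1 *m eigproj V d s2 = 0.
Proof.
move=> s12; rewrite fun_mxM // -fun_mx0.
by apply: eq_fun_mx => i; rewrite -natrM mulnb (negbTE (s12 _)).
Qed.

End SpectralPart.

Section Splitting.
Variables (R : realType) (n : nat).
Implicit Types A S P : 'M[R]_(n + n).

Lemma commute_compl P P' Z : P + P' = 1%:M -> P *m Z *m P' = 0 -> P' *m Z *m P = 0 ->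
  P *m Z = Z *m P.
Proof.
move=> PP' PZP' P'ZP; transitivity (P *m Z *m P).
  by rewrite -[LHS]mulmx1 -PP' mulmxDr PZP' addr0.
by rewrite -[RHS]mul1mx -PP' mulmxDl !mulmxA P'ZP addr0.
Qed.

(** [S] is symmetric with range equal to that of the projection [P], and is
    invertible there. *)
Record invertible_on S P : Prop := InvertibleOn {
  inv_on_sym : S^T = S;
  inv_on_range : P *m S = S;
  inv_on_inverse : exists G, S *m G = P /\ G *m S = P
}.

(** What the eigenspaces of A contribute to the argument: [Pn], [P0], [Pp] are
    the orthogonal projections onto the three of them, and [Sn], [Sp] are
    square roots of the negative and the positive part of A, each invertible on
    its eigenspace. *)
Record sign_splitting A Sn Sp Pn P0 Pp : Prop := SignSplitting {
  mem_neg : forall v, (v \in eig_neg A) = (Pn *m v == v);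
  mem_zero : forall v, (v \in eig_zero A) = (P0 *m v == v);
  mem_pos : forall v, (v \in eig_pos A) = (Pp *m v == v);
  split_sum : Pn + P0 + Pp = 1%:M;
  split_sym : [/\ Pn^T = Pn, P0^T = P0 & Pp^T = Pp];
  split_idem : [/\ Pn *m Pn = Pn, P0 *m P0 = P0 & Pp *m Pp = Pp];
  split_orth : [/\ Pn *m P0 = 0, Pn *m Pp = 0 & P0 *m Pp = 0];
  split_neg : invertible_on Sn Pn /\ A *m Pn = - (Sn *m Sn);
  split_pos : invertible_on Sp Pp /\ A *m Pp = Sp *m Sp;
  split_zero : A *m P0 = 0;
  split_basis : exists (r : nat) (Q : 'M[R]_(n + n, r)), Q^T *m Q = 1%:M /\ Q *m Q^T = P0
}.

Lemma invertible_on_fun_mx (V : 'M[R]_(n + n)) d (s : pred R) x : V^T *m V = 1%:M ->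
  (forall i, (x i != 0) = s (d i)) -> invertible_on (fun_mx V x) (eigproj V d s).
Proof.
move=> VV sx; split; first exact: fun_mxT.
  rewrite fun_mxM //; apply: eq_fun_mx => i; rewrite -sx.
  by case: eqP => [->|]; rewrite ?mulr0 ?mul1r.
exists (fun_mx V (fun i => (x i)^-1)); rewrite !fun_mxM //; split;
  apply: eq_fun_mx => i; rewrite -sx;
  by have [->|x0] := eqVneq (x i) 0; rewrite ?mul0r ?mulr0 ?mulfV ?mulVf.
Qed.

Lemma symmetric_splitting A : A^T = A ->
  exists Pn P0 Pp, sign_splitting A (sqrtmx (negmx A)) (sqrtmx (posmx A)) Pn P0 Pp.
Proof.
move=> /symmetric_diagonalization[V [dr [VV AE]]]; pose d i := dr 0 i.
have {}AE : A = fun_mx V d.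
  by rewrite AE; congr (_ *m diag_mx _ *m _); apply/rowP=> i; rewrite mxE.
pose xn i := Num.sqrt (if d i < 0 then - d i else 0).
pose xp i := Num.sqrt (if 0 < d i then d i else 0).
have -> : sqrtmx (negmx A) = fun_mx V xn.
  rewrite AE negmx_fun_mx // sqrt_fun_mx // => i.
  by case: ifP => // d0; rewrite oppr_ge0 ltW.
have -> : sqrtmx (posmx A) = fun_mx V xp.
  rewrite AE posmx_fun_mx // sqrt_fun_mx // => i.
  by case: ifP => // d0; rewrite ltW.
have xnE i : (xn i != 0) = (d i < 0).
  rewrite /xn; case: ifP => d0; last by rewrite sqrtr0 eqxx.
  by rewrite gt_eqF // sqrtr_gt0 oppr_gt0.
have xpE i : (xp i != 0) = (0 < d i).
  rewrite /xp; case: ifP => d0; last by rewrite sqrtr0 eqxx.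
  by rewrite gt_eqF // sqrtr_gt0.
exists (eigproj V d (fun a => a < 0)), (eigproj V d (pred1 0)), (eigproj V d (fun a => 0 < a)).
split.
- by move=> v; rewrite AE; apply: mem_eig_span.
- by move=> v; rewrite AE; apply: mem_eig_span => // a; split=> /eqP.
- by move=> v; rewrite AE; apply: mem_eig_span.
- rewrite !fun_mxD -(fun_mx1 VV); apply: eq_fun_mx => i.
  by rewrite /=; case: ltrgtP; rewrite ?addr0 ?add0r.
- by split; apply: fun_mxT.
- by split; apply: eigproj_idem.
- split; apply: eigproj_orth => // a; rewrite /=; first by case: ltrgtP.
    by case: ltrgtP.
  by case: ltrgtP.
- split; first exact: invertible_on_fun_mx.
  rewrite AE -scaleN1r !fun_mxM // fun_mxZ; apply: eq_fun_mx => i.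
  rewrite /xn mulN1r -expr2; case: ifP => d0; last by rewrite sqrtr0 expr0n mulr0 oppr0.
  by rewrite sqr_sqrtr ?opprK ?mulr1 // oppr_ge0 ltW.
- split; first exact: invertible_on_fun_mx.
  rewrite AE !fun_mxM //; apply: eq_fun_mx => i.
  rewrite /xp -expr2; case: ifP => d0; last by rewrite sqrtr0 expr0n mulr0.
  by rewrite sqr_sqrtr ?mulr1 // ltW.
- rewrite AE fun_mxM // -(fun_mx0 V); apply: eq_fun_mx => i /=.
  by case: eqP => [->|_]; rewrite ?mul0r ?mulr0.
exact: eigproj_orthonormal_basis.
Qed.

(** Pairwise symplectic orthogonality of the eigenspaces says that J has no
    off-diagonal blocks for their orthogonal sum. *)
Lemma splitting_J A Sn Sp Pn P0 Pp : sign_splitting A Sn Sp Pn P0 Pp -> EigSpSm A ->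
  [/\ Pn *m Jmx n = Jmx n *m Pn, P0 *m Jmx n = Jmx n *m P0 & Pp *m Jmx n = Jmx n *m Pp].
Proof.
move=> H [_ _ [onz onp ozp] _].
have [symPn symP0 symPp] := split_sym H; have [PnPn P0P0 PpPp] := split_idem H.
have sumP := split_sum H.
have [zJn nJz] := sorth_proj (mem_neg H) (mem_zero H) PnPn P0P0 symPn symP0 onz.
have [pJn nJp] := sorth_proj (mem_neg H) (mem_pos H) PnPn PpPp symPn symPp onp.
have [pJz zJp] := sorth_proj (mem_zero H) (mem_pos H) P0P0 PpPp symP0 symPp ozp.
split.
- apply: (@commute_compl _ (P0 + Pp)); first by rewrite addrA.
    by rewrite mulmxDr nJz nJp addr0.
  by rewrite !mulmxDl zJn pJn addr0.
- apply: (@commute_compl _ (Pn + Pp)); first by rewrite addrCA addrA.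
    by rewrite mulmxDr zJn zJp addr0.
  by rewrite !mulmxDl nJz pJz addr0.
apply: (@commute_compl _ (Pn + P0)); first by rewrite addrC.
  by rewrite mulmxDr pJn pJz addr0.
by rewrite !mulmxDl nJp zJp addr0.
Qed.

(** * Assembling the three eigenspaces *)

Section Frame.
Variables (A Sn Sp Pn P0 Pp : 'M[R]_(n + n)).
Hypothesis H : sign_splitting A Sn Sp Pn P0 Pp.
Hypothesis PnJ : Pn *m Jmx n = Jmx n *m Pn.
Hypothesis P0J : P0 *m Jmx n = Jmx n *m P0.
Hypothesis PpJ : Pp *m Jmx n = Jmx n *m Pp.

Lemma splitting_orthT : [/\ P0 *m Pn = 0, Pp *m Pn = 0 & Pp *m P0 = 0].
Proof.
have [symPn symP0 symPp] := split_sym H; have [PnP0 PnPp P0Pp] := split_orth H.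
split; apply: trmx_inj; rewrite trmx0 trmx_mul ?symPn ?symP0 ?symPp //.
Qed.

Variables (k l m : nat).
Variables (Q : 'M[R]_(n + n, l + l)) (Wn : 'M[R]_(n + n, k + k)) (Wp : 'M[R]_(n + n, m + m)).
Variables (b : 'I_k -> R) (c : 'I_m -> R).
Hypothesis QQ : Q^T *m Q = 1%:M.
Hypothesis QP : Q *m Q^T = P0.
Hypothesis WnWn : Wn^T *m Wn = 1%:M.
Hypothesis WnP : Wn *m Wn^T = Pn.
Hypothesis formn : Sn *m Jmx n *m Sn = Wn *m skew_fam b *m Wn^T.
Hypothesis WpWp : Wp^T *m Wp = 1%:M.
Hypothesis WpP : Wp *m Wp^T = Pp.
Hypothesis formp : Sp *m Jmx n *m Sp = Wp *m skew_fam c *m Wp^T.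

(** The trace of 1 = Pn + P0 + Pp, computed on the orthonormal bases. *)
Lemma splitting_size : n = (l + (k + m))%N.
Proof.
apply: double_inj; apply/eqP; rewrite -(eqr_nat R) -!addnn -mxtrace1 -(split_sum H).
rewrite !mxtraceD -WnP -QP -WpP mxtrace_mulC WnWn [\tr (Q *m _)]mxtrace_mulC QQ.
by rewrite [\tr (Wp *m _)]mxtrace_mulC WpWp !mxtrace1 -!natrD eqr_nat !addnn -!doubleD addnA (addnC l).
Qed.

Let PnWn : Pn *m Wn = Wn. Proof. by rewrite -WnP -mulmxA WnWn mulmx1. Qed.
Let PpWp : Pp *m Wp = Wp. Proof. by rewrite -WpP -mulmxA WpWp mulmx1. Qed.
Let P0Q : P0 *m Q = Q. Proof. by rewrite -QP -mulmxA QQ mulmx1. Qed.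

Let cross (p q : nat) (X : 'M[R]_(n + n, p)) (Y : 'M[R]_(n + n, q)) P P' :
  P *m P' = 0 -> P^T = P -> P *m X = X -> P' *m Y = Y -> X^T *m Y = 0.
Proof.
move=> PP' symP PX PY; rewrite -PX -PY trmx_mul symP mulmxA -[_ *m P *m P']mulmxA PP'.
by rewrite mulmx0 mul0mx.
Qed.

Definition frame := sconcat Q (sconcat Wn Wp).

Lemma frame_gram : frame^T *m frame = 1%:M.
Proof.
have [symPn symP0 symPp] := split_sym H; have [PnP0 PnPp P0Pp] := split_orth H.
have [P0Pn PpPn PpP0] := splitting_orthT.
rewrite -[frame^T]mulmx1 /frame !sconcat_congr ?mulmx1.
- by rewrite QQ WnWn WpWp !sdsum1.
- exact: cross PnPp _ _ _.
- exact: cross PpPn _ _ _.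
- by rewrite mul_sconcat (cross P0Pn) // (cross P0Pp) // sconcat0.
by apply: trmx_inj; rewrite trmx_mul trmxK mul_sconcat (cross P0Pn) // (cross P0Pp) // sconcat0 trmx0.
Qed.

(** Sn J Sn = Wn K Wn^T only sees the columns Wn of the frame, the other ones
    being orthogonal to them. *)
Lemma frame_neg :
  frame^T *m (Sn *m Jmx n *m Sn) *m frame =
  skewdiag_mx (row_mx 0 (row_mx (\row_i b i) 0)).
Proof.
have [symPn symP0 symPp] := split_sym H; have [PnP0 PnPp P0Pp] := split_orth H.
transitivity ((Wn^T *m frame)^T *m skew_fam b *m (Wn^T *m frame)).
  by rewrite formn trmx_mul trmxK !mulmxA.
rewrite /frame !(mul_sconcat Wn^T) WnWn (cross PnP0) // (cross PnPp) //.
rewrite !sconcat_congr ?(trmx0, mulmx0, mul0mx) //.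
by rewrite trmx1 mul1mx mulmx1 -!sdsum_skewdiag !skewdiag_mx0.
Qed.

Lemma frame_pos :
  frame^T *m (Sp *m Jmx n *m Sp) *m frame =
  skewdiag_mx (row_mx 0 (row_mx 0 (\row_i c i))).
Proof.
have [symPn symP0 symPp] := split_sym H; have [P0Pn PpPn PpP0] := splitting_orthT.
transitivity ((Wp^T *m frame)^T *m skew_fam c *m (Wp^T *m frame)).
  by rewrite formp trmx_mul trmxK !mulmxA.
rewrite /frame !(mul_sconcat Wp^T) WpWp (cross PpP0) // (cross PpPn) //.
rewrite !sconcat_congr ?(trmx0, mulmx0, mul0mx) //.
by rewrite trmx1 mul1mx mulmx1 -!sdsum_skewdiag !skewdiag_mx0.
Qed.

Hypothesis symA : A^T = A.
Hypothesis b0 : forall i, 0 < b i.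
Hypothesis c0 : forall i, 0 < c i.

(** Each part lies in the range of its own projection, and the projections commute
    with both J and A; so the Gram matrices for J and A are block diagonal. *)
Lemma williamson_basis (M0 : 'M[R]_(n + n, l + l)) (Db := diag_mx (\row_i b i))
    (Dc := diag_mx (\row_i c i))
    (M := sconcat (sconcat M0 (williamson_cols Sn Wn b)) (williamson_cols Sp Wp c)) :
  symplectic_basis (eig_zero A) M0 ->
  M^T *m Jmx n *m M = Jmx (l + k + m) /\
  M^T *m A *m M = dsum (dsum (dsum 0 (- Db)) Dc) (dsum (dsum 0 (- Db)) Dc).
Proof.
move=> basis0.
have [symPn symP0 symPp] := split_sym H; have [PnP0 PnPp P0Pp] := split_orth H.
have [P0Pn PpPn PpP0] := splitting_orthT.
have [[symSn PnSn _] ASn] := split_neg H; have [[symSp PpSp _] ASp] := split_pos H.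
have AP0 := split_zero H.
have P0M0 : P0 *m M0 = M0 := symplectic_basis_fixed (mem_zero H) basis0.
set Mn := williamson_cols Sn Wn b in M *; set Mp := williamson_cols Sp Wp c in M *.
have PnMn : Pn *m Mn = Mn by rewrite williamson_cols_range.
have PpMp : Pp *m Mp = Mp by rewrite williamson_cols_range.
have splitM Z : Pn *m Z = Z *m Pn -> P0 *m Z = Z *m P0 ->
    M^T *m Z *m M = sdsum (sdsum (M0^T *m Z *m M0) (Mn^T *m Z *m Mn)) (Mp^T *m Z *m Mp).
  move=> PnZ P0Z; rewrite (@sconcat_split _ _ _ _ (P0 + Pn)).
  - by rewrite (sconcat_split symP0 P0Z P0M0) // -PnMn mulmxA P0Pn mul0mx.
  - by rewrite linearD /= symP0 symPn.
  - by rewrite mulmxDl mulmxDr PnZ P0Z.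
  - rewrite mul_sconcat !mulmxDl P0M0 PnMn -{2}P0M0 -{1}PnMn !mulmxA PnP0 P0Pn !mul0mx.
    by rewrite addr0 add0r.
  by rewrite -PpMp mulmxA mulmxDl P0Pp PnPp addr0 mul0mx.
split.
  by rewrite splitM // (symplectic_basis_gram basis0) !williamson_cols_J // !sum_Jmx.
have PnA : Pn *m A = A *m Pn.
  by rewrite -{1}symA -symPn -trmx_mul symPn ASn linearN /= trmx_mul symSn.
have P0A : P0 *m A = A *m P0.
  by rewrite -{1}symA -symP0 -trmx_mul symP0 AP0 trmx0.
rewrite splitM //.
have -> : M0^T *m A *m M0 = dsum 0 0.
  by rewrite -P0M0 -!mulmxA [A *m _]mulmxA AP0 mul0mx mulmx0 /dsum block_mx0.
have -> : Mn^T *m A *m Mn = dsum (- Db) (- Db).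
  rewrite -{2}PnMn -!mulmxA [A *m _]mulmxA ASn mulNmx mulmxN mulmxA.
  by rewrite williamson_cols_sq // /dbl_fam /dsum opp_block_mx oppr0.
have -> : Mp^T *m A *m Mp = dsum Dc Dc.
  by rewrite -{2}PpMp -!mulmxA [A *m _]mulmxA ASp mulmxA williamson_cols_sq.
by rewrite !sdsum_dsum.
Qed.
End Frame.
End Splitting.

Theorem mainTheorem6 (R : realType) (n k l m : nat) (A : 'M[R]_(n + n))
    (hA : EigSpSm A)
    (hk : \dim (eig_neg A) = k.*2)
    (hl : \dim (eig_zero A) = l.*2)
    (hm : \dim (eig_pos A) = m.*2) :
  exists (e : (k + l + m)%N = n)
         (U : 'M[R]_(n + n)) (beta delta : 'I_(k + m) -> R)
         (i : 'I_k -> 'I_(k + m)) (j : 'I_m -> 'I_(k + m)),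
    [/\ orthogonal_mx U,
        [/\ {homo i : a b / (a < b)%N}, {homo j : a b / (a < b)%N},
            forall a b, i a != j b &
            forall c, (exists a, c = i a) \/ (exists b, c = j b)],
        (forall a, 0 < beta (i a) /\ delta (i a) = 0) /\
        (forall b, beta (j b) = 0 /\ 0 < delta (j b)),
        U^T *m sqrtmx (negmx A) *m Jmx n *m sqrtmx (negmx A) *m U
          = skew_blocks e beta /\
        U^T *m sqrtmx (posmx A) *m Jmx n *m sqrtmx (posmx A) *m U
          = skew_blocks e delta &
        let Dm : 'M[R]_k := diag_mx (\row_a beta (i a)) in
        let Dp : 'M[R]_m := diag_mx (\row_b delta (j b)) in
        let Dm' := invmx (sqrtmx Dm) in
        let Dp' := invmx (sqrtmx Dp) in
        let Mm : 'M[R]_(n + n, k + k) :=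
          Jmx n *m sqrtmx (negmx A) *m U *m Pmx n *m Pimx n l i
            *m dsum Dm' Dm' *m (Jmx k)^T in
        let Mp : 'M[R]_(n + n, m + m) :=
          Jmx n *m sqrtmx (posmx A) *m U *m Pmx n *m Pimx n l j
            *m dsum Dp' Dp' *m (Jmx m)^T in
        forall M0 : 'M[R]_(n + n, l + l),
          symplectic_basis (eig_zero A) M0 ->
          let M : 'M[R]_(n + n) :=
            castmx (erefl, sconcat_size e) (sconcat (sconcat M0 Mm) Mp) in
          let D : 'M[R]_n :=
            castmx (e, e) (dsum (dsum (- Dm) (0 : 'M[R]_l)) Dp) in
          symplectic_mx M /\
          exists s : 'S_n,
            let Ds : 'M[R]_n := mxsub s s D in
            M^T *m A *m M = dsum Ds Ds].
Proof.
have [symA _ _ _] := hA.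
have [Pn [P0 [Pp H]]] := symmetric_splitting symA.
have [PnJ P0J PpJ] := splitting_J H hA.
have [symPn symP0 symPp] := split_sym H.
set Sn := sqrtmx (negmx A) in H *; set Sp := sqrtmx (posmx A) in H *.
have [[symSn PnSn [Gn [SGn GSn]]] _] := split_neg H.
have [[symSp PpSp [Gp [SGp GSp]]] _] := split_pos H.
have [Wn [b [b0 WnWn WnP formn]]] := skew_range_form symSn PnSn PnJ symPn SGn GSn (mem_neg H) hk.
have [Wp [c [c0 WpWp WpP formp]]] := skew_range_form symSp PpSp PpJ symPp SGp GSp (mem_pos H) hm.
have [r [Q [QQ QP]]] := split_basis H.
have rl : r = (l + l)%N.
  by rewrite addnn -hl; apply/esym/(dim_orthonormal QQ) => v; rewrite QP (mem_zero H).
subst r.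
(* Writing n as l + (k + m) gives the columns of the frame the type that U needs. *)
have nE := splitting_size H QQ QP WnWn WnP WpWp WpP.
have en : (k + l + m)%N = n by rewrite nE addnA (addnC k).
subst n; exists en.
pose F := frame Q Wn Wp; pose U := F *m (Pmx (l + (k + m)))^T.
exists U, (row_mx (\row_i b i) 0 0), (row_mx 0 (\row_i c i) 0).
exists (@lshift k m), (@rshift k m).
have congrU Z : U^T *m Z *m U = mxsub (@unshuffle _) (@unshuffle _) (F^T *m Z *m F).
  by rewrite /U trmx_mul trmxK -Pmx_congr !mulmxA.
split.
- rewrite /orthogonal_mx -[U^T]mulmx1 congrU mulmx1 (frame_gram H QQ QP WnWn WnP WpWp WpP).
  by apply/matrixP=> i j; rewrite !mxE (inj_eq (@unshuffle_inj _)).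
- split=> // [x y xy|x y|x].
  + by rewrite /= ltn_add2l.
  + by rewrite eq_lrshift.
  + by have [a ->|a ->] := split_ordP x; [left|right]; exists a.
- by split=> a; rewrite !(row_mxEl, row_mxEr) !mxE.
- have sandwich S : U^T *m S *m Jmx _ *m S *m U = U^T *m (S *m Jmx _ *m S) *m U.
    by rewrite !mulmxA.
  split; rewrite sandwich congrU skew_blocksE; congr mxsub.
    exact: (frame_neg H QQ QP WnWn WnP formn WpWp WpP).
  exact: (frame_pos H QQ QP WnWn WnP WpWp WpP formp).
have -> : \row_a (row_mx (\row_i b i) 0 : 'rV_(k + m)) 0 (lshift m a) = \row_a b a.
  by apply/rowP=> a; rewrite mxE row_mxEl.
have -> : \row_a (row_mx 0 (\row_i c i) : 'rV_(k + m)) 0 (rshift k a) = \row_a c a.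
  by apply/rowP=> a; rewrite mxE row_mxEr.
move=> Dm Dp Dm' Dp' Mm Mp M0 basis0 M D.
have colsU S (q : nat) (Y : 'M[R]_(_, q)) :
    Jmx _ *m S *m U *m Pmx _ *m Y = Jmx _ *m S *m (F *m Y).
  by rewrite /U -!mulmxA [(Pmx _)^T *m _]mulmxA PmxK mul1mx.
have MmE : Mm = williamson_cols Sn Wn b by rewrite /Mm colsU sconcat_Pimxl.
have MpE : Mp = williamson_cols Sp Wp c by rewrite /Mp colsU sconcat_Pimxr.
have [JM AM] := williamson_basis H PnJ P0J PpJ WnWn formn WpWp formp symA b0 c0 basis0.
rewrite -MmE -MpE in JM AM.
split; first by rewrite /symplectic_mx /M congr_castmx JM castmx_Jmx.
have e' : (l + k + m)%N = (l + (k + m))%N by rewrite addnA.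
have [s sE] := swap_blocks_perm en e' (- Dm) 0 Dp.
by exists s; rewrite /= -sE -(castmx_dsum (sconcat_size en)) /M congr_castmx AM.
Qed.
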